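(* Let $(\mathbf{M}',\otimes,\mathbf{1},\chi)$ be a braided monoidal category which, for a set $S$, is an $S$-distributive domain, let $\mathbf{M}:=\mathbf{Coalg}(\mathbf{M}')$, and let $(\mathbf{A},\mathbf{B},\triangleright,\triangleleft,|\cdots|)$ be a matched pair of $\mathbf{M}$-categories with object set $S$. Then the bicrossed product $\mathbf{A}\Join\mathbf{B}$, which is a category enriched over $\mathbf{M}'$, is enriched over the monoidal category $\mathbf{M}=\mathbf{Coalg}(\mathbf{M}')$.
   Context: Associativity and unit constraints are suppressed, and the identity morphism of an object $X$ is also denoted $X$. $\mathbf{M}'$ is $S$-distributive if every $S$-indexed family $\{X_i\}_{i\in S}$ of objects has a coproduct $(\bigoplus_{i\in S}X_i,\{\sigma_i\}_{i\in S})$ and, for every object $X$, $(X\otimes\bigoplus_iX_i,\{X\otimes\sigma_i\})$ and $((\bigoplus_iX_i)\otimes X,\{\sigma_i\otimes X\})$ are coproducts of $\{X\otimes X_i\}$ and $\{X_i\otimes X\}$. $\mathbf{M}'$ is a domain if the tensor product of two objects is initial if and only if at least one of them is initial (a monoidal category without initial objects is a domain by convention). $\mathbf{Coalg}(\mathbf{M}')$ is the category of coassociative counital coalgebras in $\mathbf{M}'$, monoidal with $\Delta_{C\otimes D}=(C\otimes\chi_{C,D}\otimes D)\circ(\Delta_C\otimes\Delta_D)$ and $\varepsilon_{C\otimes D}=\varepsilon_C\otimes\varepsilon_D$. A coproduct $\bigoplus_iC_i$ in $\mathbf{M}'$ of coalgebras is regarded as a coalgebra with the unique structure for which the canonical inclusions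 are coalgebra morphisms; the hom-objects of $\mathbf{A}\Join\mathbf{B}$ below are coalgebras in this way. For a monoidal category $\mathbf{N}$, an $\mathbf{N}$-category $\mathbf{A}$ with object set $S$ consists of objects ${}_xA_y$ of $\mathbf{N}$ (playing the role of $\mathrm{Hom}(y,x)$), composition morphisms ${}_xa_z^y:{}_xA_y\otimes{}_yA_z\to{}_xA_z$ and identities $1_x^A:\mathbf{1}\to{}_xA_x$, satisfying the usual associativity and unit axioms; for $\mathbf{B}$ the data are ${}_xB_y,{}_xb_z^y,1_x^B$. For $\mathbf{N}=\mathbf{M}$ the hom-objects are coalgebras with counits ${}_x\varepsilon_y^A$, ${}_x\varepsilon_y^B$, and compositions and identities are coalgebra morphisms. Matched pair. Let $|\cdots|:S^3\to S$ be a function and let ${}_x\triangleright_z^y:{}_xB_y\otimes{}_yA_z\to{}_xA_{|xyz|}$, ${}_x\triangleleft_z^y:{}_xB_y\otimes{}_yA_z\to{}_{|xyz|}B_z$ ($x,y,z\in S$) be coalgebra morphisms with $$({}_x\triangleleft_z^y\otimes{}_x\triangleright_z^y)\circ\Delta_{{}_xB_y\otimes{}_yA_z}=\chi_{{}_xA_{|xyz|},{}_{|xyz|}B_z}\circ({}_x\triangleright_z^y\otimes{}_x\triangleleft_z^y)\circ\Delta_{{}_xB_y\otimes{}_yA_z}.$$ Then $(\mathbf{A},\mathbf{B},\triangleright,\triangleleft,|\cdots|)$ is a matched pair of $\mathbf{M}$-categories if for all $x,y,z,t\in S$ (''initial'' meaning initial in $\mathbf{M}'$): (i) if ${}_xB_y\otimes{}_yA_z$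 is not initial, then ${}_xA_{|xyz|}\otimes{}_{|xyz|}B_z$ is not initial; (ii) if ${}_xB_y\otimes{}_yB_z\otimes{}_zA_t$ is not initial, then $|xy|yzt||=|xzt|$, ${}_x\triangleleft_t^z\circ({}_xb_z^y\otimes{}_zA_t)={}_{|xzt|}b_t^{|yzt|}\circ({}_x\triangleleft_{|yzt|}^y\otimes{}_{|yzt|}B_t)\circ({}_xB_y\otimes{}_y\triangleright_t^z\otimes{}_y\triangleleft_t^z)\circ({}_xB_y\otimes\Delta_{{}_yB_z\otimes{}_zA_t})$ and ${}_x\triangleright_t^z\circ({}_xb_z^y\otimes{}_zA_t)={}_x\triangleright_{|yzt|}^y\circ({}_xB_y\otimes{}_y\triangleright_t^z)$; (iii) if ${}_xB_y\otimes{}_yA_z\otimes{}_zA_t$ is not initial, then $||xyz|zt|=|xyt|$, ${}_x\triangleright_t^y\circ({}_xB_y\otimes{}_ya_t^z)={}_xa_{|xyt|}^{|xyz|}\circ({}_xA_{|xyz|}\otimes{}_{|xyz|}\triangleright_t^z)\circ({}_x\triangleright_z^y\otimes{}_x\triangleleft_z^y\otimes{}_zA_t)\circ(\Delta_{{}_xB_y\otimes{}_yA_z}\otimes{}_zA_t)$ and ${}_x\triangleleft_t^y\circ({}_xB_y\otimes{}_ya_t^z)={}_{|xyz|}\triangleleft_t^z\circ({}_x\triangleleft_z^y\otimes{}_zA_t)$; (iv) if ${}_xA_y$ is not initial, then $|xxy|=y$, ${}_x\triangleleft_y^x\circ(1_x^B\otimes{}_xA_y)={}_x\varepsilon_y^A\otimes1_y^B$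 and ${}_x\triangleright_y^x\circ(1_x^B\otimes{}_xA_y)={}_xA_y$; (v) if ${}_xB_y$ is not initial, then $|xyy|=x$, ${}_x\triangleleft_y^y\circ({}_xB_y\otimes1_y^A)={}_xB_y$ and ${}_x\triangleright_y^y\circ({}_xB_y\otimes1_y^A)=1_x^A\otimes{}_x\varepsilon_y^B$. Bicrossed product. Put ${}_x\widetilde{R}_z^y:=({}_x\triangleright_z^y\otimes{}_x\triangleleft_z^y)\circ\Delta_{{}_xB_y\otimes{}_yA_z}$. The bicrossed product $\mathbf{A}\Join\mathbf{B}$ is the $\mathbf{M}'$-category with object set $S$, hom-objects ${}_x(\mathbf{A}\Join\mathbf{B})_y:=\bigoplus_{u\in S}{}_xA_u\otimes{}_uB_y$ with canonical inclusions ${}_x\sigma_y^u$, composition ${}_xc_z^y$ the unique morphism such that for all $u,v\in S$ $${}_xc_z^y\circ({}_x\sigma_y^u\otimes{}_y\sigma_z^v)={}_x\sigma_z^{|uyv|}\circ({}_xa_{|uyv|}^u\otimes{}_{|uyv|}b_z^v)\circ({}_xA_u\otimes{}_u\widetilde{R}_v^y\otimes{}_vB_z),$$ and identities $1_x:={}_x\sigma_x^x\circ(1_x^A\otimes1_x^B)$. *)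

(* Defs.v *)
From Stdlib Require Import ssreflect ssrfun ProofIrrelevance.

Set Implicit Arguments.
Unset Strict Implicit.
Unset Printing Implicit Defensive.

Declare Scope cat_scope.
Delimit Scope cat_scope with cat.
Local Open Scope cat_scope.

Record MonoidalCategory := {
  obj :> Type;
  hom : obj -> obj -> Type;
  idm : forall X, hom X X;
  comp : forall X Y Z, hom Y Z -> hom X Y -> hom X Z;
  comp_idl : forall X Y (f : hom X Y), comp (idm Y) f = f;
  comp_idr : forall X Y (f : hom X Y), comp f (idm X) = f;
  comp_assoc : forall X Y Z T (h : hom Z T) (g : hom Y Z) (f : hom X Y),
    comp (comp h g) f = comp h (comp g f);
  tens : obj -> obj -> obj;
  tensm : forall X X' Y Y', hom X X' -> hom Y Y' -> hom (tens X Y) (tens X' Y');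
  tensm_id : forall X Y, tensm (idm X) (idm Y) = idm (tens X Y);
  tensm_comp : forall X X' X'' Y Y' Y''
      (f' : hom X' X'') (f : hom X X') (g' : hom Y' Y'') (g : hom Y Y'),
    tensm (comp f' f) (comp g' g) = comp (tensm f' g') (tensm f g);
  tunit : obj;
  assoc : forall X Y Z, hom (tens (tens X Y) Z) (tens X (tens Y Z));
  assoc_inv : forall X Y Z, hom (tens X (tens Y Z)) (tens (tens X Y) Z);
  assocK : forall X Y Z, comp (assoc_inv X Y Z) (assoc X Y Z) = idm _;
  assoc_invK : forall X Y Z, comp (assoc X Y Z) (assoc_inv X Y Z) = idm _;
  assoc_nat : forall X X' Y Y' Z Z' (f : hom X X') (g : hom Y Y') (h : hom Z Z'),
    comp (assoc X' Y' Z') (tensm (tensm f g) h)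
    = comp (tensm f (tensm g h)) (assoc X Y Z);
  lunit : forall X, hom (tens tunit X) X;
  lunit_inv : forall X, hom X (tens tunit X);
  lunitK : forall X, comp (lunit_inv X) (lunit X) = idm _;
  lunit_invK : forall X, comp (lunit X) (lunit_inv X) = idm _;
  lunit_nat : forall X Y (f : hom X Y),
    comp (lunit Y) (tensm (idm tunit) f) = comp f (lunit X);
  runit : forall X, hom (tens X tunit) X;
  runit_inv : forall X, hom X (tens X tunit);
  runitK : forall X, comp (runit_inv X) (runit X) = idm _;
  runit_invK : forall X, comp (runit X) (runit_inv X) = idm _;
  runit_nat : forall X Y (f : hom X Y),
    comp (runit Y) (tensm f (idm tunit)) = comp f (runit X);
  pentagon : forall X Y Z T,
    comp (tensm (idm X) (assoc Y Z T))
      (comp (assoc X (tens Y Z) T) (tensm (assoc X Y Z) (idm T)))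
    = comp (assoc X Y (tens Z T)) (assoc (tens X Y) Z T);
  triangle : forall X Y,
    comp (tensm (idm X) (lunit Y)) (assoc X tunit Y) = tensm (runit X) (idm Y)
}.

Arguments hom {m} _ _.
Arguments idm {m} X.
Arguments comp {m X Y Z} _ _.
Arguments tens {m} _ _.
Arguments tensm {m X X' Y Y'} _ _.
Arguments tunit {m}.
Arguments assoc {m} X Y Z.
Arguments assoc_inv {m} X Y Z.
Arguments lunit {m} X.
Arguments lunit_inv {m} X.
Arguments runit {m} X.
Arguments runit_inv {m} X.

Notation "g ∘ f" := (comp g f) (at level 40, left associativity) : cat_scope.
Notation "X ⊗ Y" := (tens X Y) (at level 38, left associativity) : cat_scope.
Notation "f ⊠ g" := (tensm f g) (at level 38, left associativity) : cat_scope.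

(** [braid_hexagon_l] and [braid_hexagon_r] express [braid (X ⊗ Y) Z] and
    [braid X (Y ⊗ Z)] through the braidings of the factors. *)
Record BraidedCategory := {
  bmon :> MonoidalCategory;
  braid : forall X Y : bmon, hom (X ⊗ Y) (Y ⊗ X);
  braid_inv : forall X Y : bmon, hom (Y ⊗ X) (X ⊗ Y);
  braidK : forall X Y, braid_inv X Y ∘ braid X Y = idm _;
  braid_invK : forall X Y, braid X Y ∘ braid_inv X Y = idm _;
  braid_nat : forall (X X' Y Y' : bmon) (f : hom X X') (g : hom Y Y'),
    braid X' Y' ∘ (f ⊠ g) = (g ⊠ f) ∘ braid X Y;
  braid_hexagon_l : forall X Y Z : bmon,
    assoc_inv Z X Y ∘ (braid (X ⊗ Y) Z ∘ assoc_inv X Y Z)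
    = (braid X Z ⊠ idm Y) ∘ (assoc_inv X Z Y ∘ (idm X ⊠ braid Y Z));
  braid_hexagon_r : forall X Y Z : bmon,
    assoc Y Z X ∘ (braid X (Y ⊗ Z) ∘ assoc X Y Z)
    = (idm Y ⊠ braid X Z) ∘ (assoc Y X Z ∘ (braid X Y ⊠ idm Z))
}.

Arguments braid {b} X Y.

(** [mid X g W] is the morphism written [X ⊗ g ⊗ W] when associativity
    constraints are suppressed. *)
Definition mid {M : MonoidalCategory} (X : M) {Y Z Y' Z' : M}
    (g : hom (Y ⊗ Z) (Y' ⊗ Z')) (W : M) :
    hom ((X ⊗ Y) ⊗ (Z ⊗ W)) ((X ⊗ Y') ⊗ (Z' ⊗ W)) :=
  assoc_inv X Y' (Z' ⊗ W)
  ∘ (idm X ⊠ (assoc Y' Z' W ∘ ((g ⊠ idm W) ∘ assoc_inv Y Z W)))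
  ∘ assoc X Y (Z ⊗ W).

Section Strictification.
Variable M : MonoidalCategory.
Implicit Types X Y Z T : M.

Lemma comp_assoc_eq X Y Z T (h : hom Y Z) (g : hom X Y) (k : hom X Z) (f : hom T X) :
  h ∘ g = k -> h ∘ (g ∘ f) = k ∘ f.
Proof. by move=> <-; rewrite comp_assoc. Qed.

Lemma tensm_idl X Y Y' Y'' (g' : hom Y' Y'') (g : hom Y Y') :
  idm X ⊠ (g' ∘ g) = (idm X ⊠ g') ∘ (idm X ⊠ g).
Proof. by rewrite -tensm_comp comp_idl. Qed.

Lemma tensm_idr X Y Y' Y'' (g' : hom Y' Y'') (g : hom Y Y') :
  (g' ∘ g) ⊠ idm X = (g' ⊠ idm X) ∘ (g ⊠ idm X).
Proof. by rewrite -tensm_comp comp_idl. Qed.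

Lemma tensm_split X X' Y Y' (f : hom X X') (g : hom Y Y') :
  f ⊠ g = (f ⊠ idm Y') ∘ (idm X ⊠ g).
Proof. by rewrite -tensm_comp comp_idl comp_idr. Qed.

Lemma tensm_swap X X' Y Y' (f : hom X X') (g : hom Y Y') :
  (f ⊠ idm Y') ∘ (idm X ⊠ g) = (idm X' ⊠ g) ∘ (f ⊠ idm Y).
Proof. by rewrite -!tensm_comp !comp_idl !comp_idr. Qed.

Lemma assoc_inv_nat X X' Y Y' Z Z' (f : hom X X') (g : hom Y Y') (h : hom Z Z') :
  assoc_inv X' Y' Z' ∘ (f ⊠ (g ⊠ h)) = ((f ⊠ g) ⊠ h) ∘ assoc_inv X Y Z.
Proof.
rewrite -[LHS]comp_idr -(assoc_invK X Y Z) comp_assoc -(comp_assoc (f ⊠ _)).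
by rewrite -assoc_nat -!(comp_assoc (assoc_inv _ _ _)) assocK comp_idl.
Qed.

Lemma comp_can_l X Y Z (h : hom Y Z) (h' : hom Z Y) (f g : hom X Y) :
  h' ∘ h = idm Y -> h ∘ f = h ∘ g -> f = g.
Proof.
by move=> hK e; rewrite -(comp_idl f) -(comp_idl g) -hK !comp_assoc e.
Qed.

Lemma comp_can_r X Y Z (h : hom X Y) (h' : hom Y X) (f g : hom Y Z) :
  h ∘ h' = idm Y -> f ∘ h = g ∘ h -> f = g.
Proof.
by move=> hK e; rewrite -(comp_idr f) -(comp_idr g) -hK -!comp_assoc e.
Qed.

Lemma tensm_runit_inj X Y (f g : hom X Y) :
  f ⊠ idm tunit = g ⊠ idm tunit -> f = g.
Proof.
move=> e; apply: (comp_can_r (runit_invK X)).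
by rewrite -!runit_nat e.
Qed.

Lemma tensm_lunit_inj X Y (f g : hom X Y) :
  idm tunit ⊠ f = idm tunit ⊠ g -> f = g.
Proof.
move=> e; apply: (comp_can_r (lunit_invK X)).
by rewrite -!lunit_nat e.
Qed.

Lemma lunit_tens X Y : lunit (X ⊗ Y) ∘ assoc tunit X Y = lunit X ⊠ idm Y.
Proof.
apply: tensm_lunit_inj; rewrite tensm_idl.
have rK : assoc tunit (tunit ⊗ X) Y ∘ (assoc tunit tunit X ⊠ idm Y)
    ∘ ((assoc_inv tunit tunit X ⊠ idm Y) ∘ assoc_inv tunit (tunit ⊗ X) Y) = idm _.
  rewrite comp_assoc (comp_assoc_eq (k := idm _)) ?comp_idl ?assoc_invK //.
  by rewrite -tensm_comp assoc_invK comp_idl tensm_id.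
apply: (comp_can_r rK).
rewrite comp_assoc pentagon -comp_assoc triangle.
rewrite -(comp_assoc (idm tunit ⊠ (lunit X ⊠ idm Y))) -assoc_nat comp_assoc.
rewrite -tensm_idr triangle -(tensm_id X Y) -assoc_nat //.
Qed.

(** Objects with a chosen bracketing.  Acting on the left of a tail object [T],
    a bracketed object becomes right-nested ([act]); transported along this
    identification ([star]), all the structural isomorphisms are identities. *)
Inductive tree := At of M | I | Tn of tree & tree.

Fixpoint ev (e : tree) : M :=
  match e with At X => X | I => tunit | Tn a b => ev a ⊗ ev b end.

Fixpoint act (e : tree) (T : M) : M :=
  match e with At X => X ⊗ T | I => T | Tn a b => act a (act b T) end.

Fixpoint actm (e : tree) T T' (g : hom T T') : hom (act e T) (act e T') :=
  match e with
  | At X => idm X ⊠ g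
  | I => g
  | Tn a b => actm a (actm b g)
  end.

Fixpoint phi (e : tree) T : hom (ev e ⊗ T) (act e T) :=
  match e with
  | At X => idm _
  | I => lunit T
  | Tn a b => phi a (act b T) ∘ ((idm (ev a) ⊠ phi b T) ∘ assoc (ev a) (ev b) T)
  end.

Fixpoint phi_inv (e : tree) T : hom (act e T) (ev e ⊗ T) :=
  match e with
  | At X => idm _
  | I => lunit_inv T
  | Tn a b =>
      assoc_inv (ev a) (ev b) T ∘ ((idm (ev a) ⊠ phi_inv b T) ∘ phi_inv a (act b T))
  end.

Lemma phiK e T : phi_inv e T ∘ phi e T = idm _.
Proof.
elim: e T => [X||a IHa b IHb] T /=; rewrite ?comp_idl ?lunitK //.
rewrite !comp_assoc (comp_assoc_eq _ (IHa _)) comp_idl.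
rewrite (comp_assoc_eq (k := idm _)); first by rewrite -tensm_idl IHb tensm_id.
by rewrite comp_idl assocK.
Qed.

Lemma phi_invK e T : phi e T ∘ phi_inv e T = idm _.
Proof.
elim: e T => [X||a IHa b IHb] T /=; rewrite ?comp_idl ?lunit_invK //.
rewrite !comp_assoc (comp_assoc_eq _ (assoc_invK _ _ _)) comp_idl.
rewrite (comp_assoc_eq (k := idm _)); first by rewrite -tensm_idl IHb tensm_id.
by rewrite comp_idl IHa.
Qed.

Lemma phi_nat e T T' (g : hom T T') : phi e T' ∘ (idm (ev e) ⊠ g) = actm e g ∘ phi e T.
Proof.
elim: e T T' g => [X||a IHa b IHb] T T' g /=.
- by rewrite comp_idl comp_idr.
- by rewrite lunit_nat.
- rewrite !comp_assoc -tensm_id assoc_nat -(comp_assoc (idm _ ⊠ phi b T')).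
  by rewrite -tensm_idl IHb tensm_idl -!comp_assoc IHa.
Qed.

(** [star] is sealed, lest rewriting with [comp_assoc] unfold it. *)
Fact star_sig (e e' : tree) (f : hom (ev e) (ev e')) T :
  {h : hom (act e T) (act e' T) | h = phi e' T ∘ ((f ⊠ idm T) ∘ phi_inv e T)}.
Proof. by eexists. Qed.

Definition star (e e' : tree) (f : hom (ev e) (ev e')) T : hom (act e T) (act e' T) :=
  proj1_sig (star_sig f T).
Arguments star : clear implicits.

Lemma star_phi e e' f T : star e e' f T ∘ phi e T = phi e' T ∘ (f ⊠ idm T).
Proof. by rewrite /star (proj2_sig (star_sig f T)) !comp_assoc phiK comp_idr. Qed.

Lemma starP e e' f T h :
  phi e' T ∘ (f ⊠ idm T) = h ∘ phi e T -> star e e' f T = h.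
Proof. by rewrite -star_phi; apply: comp_can_r; apply: phi_invK. Qed.

Lemma star_inj e e' (f g : hom (ev e) (ev e')) :
  star e e' f tunit = star e e' g tunit -> f = g.
Proof.
move=> h; apply: tensm_runit_inj; apply: (comp_can_l (phiK e' tunit)).
by rewrite -!star_phi h.
Qed.

Lemma star_nat e e' f T T' (g : hom T T') :
  star e e' f T' ∘ actm e g = actm e' g ∘ star e e' f T.
Proof.
apply: (comp_can_r (phi_invK e T)).
rewrite !comp_assoc -phi_nat star_phi -comp_assoc star_phi.
by rewrite comp_assoc tensm_swap -!comp_assoc phi_nat.
Qed.

Lemma star_comp e' e e'' (g : hom (ev e') (ev e'')) (f : hom (ev e) (ev e')) T :
  star e e'' (g ∘ f) T = star e' e'' g T ∘ star e e' f T.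
Proof.
by apply: starP; rewrite comp_assoc star_phi tensm_idr -!comp_assoc star_phi.
Qed.

Lemma star_id e T : star e e (idm _) T = idm _.
Proof. by apply: starP; rewrite tensm_id comp_idl comp_idr. Qed.

Lemma star_tens a a' b b' (f : hom (ev a) (ev a')) (g : hom (ev b) (ev b')) T :
  star (Tn a b) (Tn a' b') (f ⊠ g) T = star a a' f (act b' T) ∘ actm a (star b b' g T).
Proof.
apply: starP => /=.
rewrite !comp_assoc assoc_nat.
rewrite -(comp_assoc (actm _ _)) -phi_nat (comp_assoc (phi a _)).
rewrite -(comp_assoc (idm _ ⊠ star _ _ _ _)) -tensm_idl star_phi tensm_idl.
rewrite -(comp_assoc (star _ _ _ _)) star_phi !comp_assoc; congr (_ ∘ _).
rewrite (tensm_split f) !comp_assoc -!(comp_assoc _ _ (assoc _ _ _)).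
by rewrite -!comp_assoc -tensm_swap.
Qed.

Lemma star_assoc a b c T : star (Tn (Tn a b) c) (Tn a (Tn b c)) (assoc _ _ _) T = idm _.
Proof.
apply: starP; rewrite comp_idl /=.
rewrite !tensm_idl !comp_assoc; congr (_ ∘ _).
rewrite pentagon -!comp_assoc; congr (_ ∘ _).
by rewrite !comp_assoc -assoc_nat tensm_id.
Qed.

Lemma star_lunit a T : star (Tn I a) a (lunit _) T = idm _.
Proof.
by apply: starP; rewrite comp_idl /= -lunit_tens -!comp_assoc lunit_nat.
Qed.

Lemma star_runit a T : star (Tn a I) a (runit _) T = idm _.
Proof. by apply: starP; rewrite comp_idl /= triangle. Qed.

Lemma star_assoc_inv a b c T :
  star (Tn a (Tn b c)) (Tn (Tn a b) c) (assoc_inv _ _ _) T = idm _.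
Proof.
have := star_comp (e' := Tn a (Tn b c)) (e := Tn (Tn a b) c) (e'' := Tn (Tn a b) c)
  (assoc_inv _ _ _) (assoc _ _ _) T.
by rewrite assocK star_id star_assoc comp_idr.
Qed.

Lemma star_lunit_inv a T : star a (Tn I a) (lunit_inv _) T = idm _.
Proof.
have := star_comp (e' := a) (e := Tn I a) (e'' := Tn I a) (lunit_inv _) (lunit _) T.
by rewrite lunitK star_id star_lunit comp_idr.
Qed.

Lemma star_runit_inv a T : star a (Tn a I) (runit_inv _) T = idm _.
Proof.
have := star_comp (e' := a) (e := Tn a I) (e'' := Tn a I) (runit_inv _) (runit _) T.
by rewrite runitK star_id star_runit comp_idr.
Qed.

Lemma actm_id e T : actm e (idm T) = idm _.
Proof. by elim: e T => [X||a IHa b IHb] T /=; rewrite ?tensm_id ?IHb ?IHa. Qed.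

Lemma actm_comp e T T' T'' (g' : hom T' T'') (g : hom T T') :
  actm e (g' ∘ g) = actm e g' ∘ actm e g.
Proof.
by elim: e T T' T'' g' g => [X||a IHa b IHb] * /=; rewrite ?tensm_idl ?IHb ?IHa.
Qed.

End Strictification.

Arguments star {M} e e' f T.
Arguments star_inj {M} e e' [f g] _.
Arguments star_comp {M} e' {e e''} g f T.

Section Interchange.
Variable M : BraidedCategory.
Implicit Types (X Y Z T : M) (a b c d : tree M).

Lemma star_braid_l a b c T :
  star (Tn (Tn a b) c) (Tn c (Tn a b)) (braid _ _) T
  = star (Tn a c) (Tn c a) (braid _ _) (act b T)
    ∘ actm a (star (Tn b c) (Tn c b) (braid _ _) T).
Proof.
have := f_equal (fun f => star (Tn a (Tn b c)) (Tn (Tn c a) b) f T)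
  (braid_hexagon_l (ev a) (ev b) (ev c)).
rewrite /= (star_comp (Tn c (Tn a b))) (star_comp (Tn (Tn a b) c)).
rewrite (star_comp (Tn (Tn a c) b)) (star_comp (Tn a (Tn c b))).
rewrite !star_assoc_inv !star_tens !star_id /= !actm_id !comp_idl !comp_idr => -> //.
Qed.

Lemma star_braid_r a b c T :
  star (Tn a (Tn b c)) (Tn (Tn b c) a) (braid _ _) T
  = actm b (star (Tn a c) (Tn c a) (braid _ _) T)
    ∘ star (Tn a b) (Tn b a) (braid _ _) (act c T).
Proof.
have := f_equal (fun f => star (Tn (Tn a b) c) (Tn b (Tn c a)) f T)
  (braid_hexagon_r (ev a) (ev b) (ev c)).
rewrite /= (star_comp (Tn (Tn b c) a)) (star_comp (Tn a (Tn b c))).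
rewrite (star_comp (Tn b (Tn a c))) (star_comp (Tn (Tn b a) c)).
rewrite !star_assoc !star_tens !star_id /= !actm_id !comp_idl !comp_idr => -> //.
Qed.

Lemma comp_idem_iso X (f g : hom X X) : g ∘ f = idm X -> f ∘ f = f -> f = idm X.
Proof. by move=> gf ff; apply: (comp_can_l gf); rewrite ff comp_idr. Qed.

Lemma star_braid_1l a T : star (Tn (I M) a) (Tn a (I M)) (braid _ _) T = idm _.
Proof.
apply: (@comp_idem_iso (act a T) _ (star (Tn a (I M)) (Tn (I M) a) (braid_inv _ _) T)).
  have <- := star_comp (e := Tn (I M) a) (Tn a (I M)) (e'' := Tn (I M) a)
    (braid_inv _ _) (braid _ _) T.
  by rewrite braidK star_id.
have /= <- := star_braid_l (I M) (I M) a T.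
have := f_equal (fun f => star (Tn (Tn (I M) (I M)) a) (Tn a (I M)) f T)
  (braid_nat (lunit tunit) (idm (ev a))).
rewrite (star_comp (Tn (I M) a)) (star_comp (Tn a (Tn (I M) (I M)))).
by rewrite !star_tens !star_lunit !star_id /= !actm_id !comp_idl !comp_idr.
Qed.

Lemma star_braid_1r a T : star (Tn a (I M)) (Tn (I M) a) (braid _ _) T = idm _.
Proof.
apply: (@comp_idem_iso (act a T) _ (star (Tn (I M) a) (Tn a (I M)) (braid_inv _ _) T)).
  have <- := star_comp (e := Tn a (I M)) (Tn (I M) a) (e'' := Tn a (I M))
    (braid_inv _ _) (braid _ _) T.
  by rewrite braidK star_id.
have /= <- := star_braid_r a (I M) (I M) T.
have := f_equal (fun f => star (Tn a (Tn (I M) (I M))) (Tn (I M) a) f T)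
  (braid_nat (idm (ev a)) (lunit tunit)).
rewrite (star_comp (Tn a (I M))) (star_comp (Tn (Tn (I M) (I M)) a)).
by rewrite !star_tens !star_lunit !star_id /= !actm_id !comp_idl !comp_idr.
Qed.

Lemma star_mid a b c b' c' d (g : hom (ev b ⊗ ev c) (ev b' ⊗ ev c')) T :
  star (Tn (Tn a b) (Tn c d)) (Tn (Tn a b') (Tn c' d)) (mid (ev a) g (ev d)) T
  = actm a (star (Tn b c) (Tn b' c') g (act d T)).
Proof.
rewrite /mid (star_comp (Tn a (Tn b (Tn c d)))) (star_comp (Tn a (Tn b' (Tn c' d)))).
rewrite star_assoc star_assoc_inv star_tens star_id comp_idl comp_idr comp_idl.
rewrite (star_comp (Tn (Tn b' c') d)) (star_comp (Tn (Tn b c) d)).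
by rewrite star_assoc star_assoc_inv star_tens star_id /= !actm_id comp_idl !comp_idr.
Qed.

Arguments star_mid a b c b' c' d g T : clear implicits.

Fact interchange_sig X Y Z T :
  {f : hom ((X ⊗ Y) ⊗ (Z ⊗ T)) ((X ⊗ Z) ⊗ (Y ⊗ T)) | mid X (braid Y Z) T = f}.
Proof. by eexists. Qed.

Definition interchange X Y Z T : hom ((X ⊗ Y) ⊗ (Z ⊗ T)) ((X ⊗ Z) ⊗ (Y ⊗ T)) :=
  proj1_sig (interchange_sig X Y Z T).

Lemma interchangeE X Y Z T : mid X (braid Y Z) T = interchange X Y Z T.
Proof. exact: proj2_sig (interchange_sig X Y Z T). Qed.

Lemma mid_nat X X' Y1 Y1' Z1 Z1' Y2 Y2' Z2 Z2' T T' (f : hom X X') (k : hom T T')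
    (y1 : hom Y1 Y1') (z1 : hom Z1 Z1') (y2 : hom Y2 Y2') (z2 : hom Z2 Z2')
    (g : hom (Y1 ⊗ Z1) (Y2 ⊗ Z2)) (g' : hom (Y1' ⊗ Z1') (Y2' ⊗ Z2')) :
  g' ∘ (y1 ⊠ z1) = (y2 ⊠ z2) ∘ g ->
  mid X' g' T' ∘ ((f ⊠ y1) ⊠ (z1 ⊠ k)) = ((f ⊠ y2) ⊠ (z2 ⊠ k)) ∘ mid X g T.
Proof.
move=> gg'.
have E1 : (assoc _ _ _ ∘ ((g' ⊠ idm T') ∘ assoc_inv _ _ _)) ∘ (y1 ⊠ (z1 ⊠ k))
    = (y2 ⊠ (z2 ⊠ k)) ∘ (assoc _ _ _ ∘ ((g ⊠ idm T) ∘ assoc_inv _ _ _)).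
  rewrite !comp_assoc assoc_inv_nat -(comp_assoc (g' ⊠ _)) -tensm_comp gg'.
  rewrite comp_idl -[k in LHS]comp_idr tensm_comp !comp_assoc.
  by rewrite (comp_assoc_eq _ (assoc_nat _ _ _)) comp_assoc.
have E2 := tensm_comp (idm X') f _ (y1 ⊠ (z1 ⊠ k)).
rewrite /mid !comp_assoc assoc_nat -!(comp_assoc (idm X' ⊠ _)) -E2 E1 comp_idl.
rewrite -[f in LHS]comp_idr tensm_comp !comp_assoc.
by rewrite (comp_assoc_eq _ (assoc_inv_nat _ _ _)) comp_assoc.
Qed.

Lemma interchange_nat X X' Y Y' Z Z' T T'
    (f : hom X X') (g : hom Y Y') (h : hom Z Z') (k : hom T T') :
  interchange X' Y' Z' T' ∘ ((f ⊠ g) ⊠ (h ⊠ k))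
  = ((f ⊠ h) ⊠ (g ⊠ k)) ∘ interchange X Y Z T.
Proof. by rewrite -!interchangeE; apply: mid_nat; apply: braid_nat. Qed.

Lemma interchange_assoc X X' Y Y' Z Z' :
  (assoc X Y Z ⊠ assoc X' Y' Z')
  ∘ (interchange (X ⊗ Y) (X' ⊗ Y') Z Z' ∘ (interchange X X' Y Y' ⊠ idm (Z ⊗ Z')))
  = interchange X X' (Y ⊗ Z) (Y' ⊗ Z')
    ∘ ((idm (X ⊗ X') ⊠ interchange Y Y' Z Z') ∘ assoc (X ⊗ X') (Y ⊗ Y') (Z ⊗ Z')).
Proof.
rewrite -!interchangeE; pose x := At X; pose y := At Y; pose z := At Z.
pose x' := At X'; pose y' := At Y'; pose z' := At Z'.
apply: (star_inj (Tn (Tn (Tn x x') (Tn y y')) (Tn z z'))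
                 (Tn (Tn x (Tn y z)) (Tn x' (Tn y' z')))).
rewrite (star_comp (Tn (Tn (Tn x y) z) (Tn (Tn x' y') z'))).
rewrite (star_comp (Tn (Tn (Tn x y) (Tn x' y')) (Tn z z'))).
rewrite (star_comp (Tn (Tn x x') (Tn (Tn y z) (Tn y' z')))).
rewrite (star_comp (Tn (Tn x x') (Tn (Tn y y') (Tn z z')))).
rewrite !star_tens !star_assoc.
rewrite (star_mid (Tn x y) (Tn x' y') z z (Tn x' y') z').
rewrite (star_mid x x' y y x' y').
rewrite (star_mid x x' (Tn y z) (Tn y z) x' (Tn y' z')).
rewrite (star_mid y y' z z y' z').
rewrite star_braid_l star_braid_r !star_id /= !tensm_id !comp_idl !comp_idr.
rewrite !tensm_idl !comp_assoc; congr (_ ∘ _).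
have /= e := star_nat (e := Tn x' y) (e' := Tn y x') (braid X' Y)
  (star (Tn y' z) (Tn z y') (braid Y' Z) (Z' ⊗ tunit)).
by rewrite -!tensm_idl; congr (_ ⊠ _); rewrite -e.
Qed.

Lemma interchange_coassoc X1 X2 X3 Y1 Y2 Y3 :
  assoc (X1 ⊗ Y1) (X2 ⊗ Y2) (X3 ⊗ Y3)
  ∘ ((interchange X1 X2 Y1 Y2 ⊠ idm (X3 ⊗ Y3))
     ∘ interchange (X1 ⊗ X2) X3 (Y1 ⊗ Y2) Y3)
  = (idm (X1 ⊗ Y1) ⊠ interchange X2 X3 Y2 Y3)
    ∘ (interchange X1 (X2 ⊗ X3) Y1 (Y2 ⊗ Y3) ∘ (assoc X1 X2 X3 ⊠ assoc Y1 Y2 Y3)).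
Proof.
rewrite -!interchangeE; pose x1 := At X1; pose x2 := At X2; pose x3 := At X3.
pose y1 := At Y1; pose y2 := At Y2; pose y3 := At Y3.
apply: (star_inj (Tn (Tn (Tn x1 x2) x3) (Tn (Tn y1 y2) y3))
                 (Tn (Tn x1 y1) (Tn (Tn x2 y2) (Tn x3 y3)))).
rewrite (star_comp (Tn (Tn (Tn x1 y1) (Tn x2 y2)) (Tn x3 y3))).
rewrite (star_comp (Tn (Tn (Tn x1 x2) (Tn y1 y2)) (Tn x3 y3))).
rewrite (star_comp (Tn (Tn x1 y1) (Tn (Tn x2 x3) (Tn y2 y3)))).
rewrite (star_comp (Tn (Tn x1 (Tn x2 x3)) (Tn y1 (Tn y2 y3)))).
rewrite !star_tens !star_assoc.
rewrite (star_mid (Tn x1 x2) x3 (Tn y1 y2) (Tn y1 y2) x3 y3).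
rewrite (star_mid x1 x2 y1 y1 x2 y2).
rewrite (star_mid x1 (Tn x2 x3) y1 y1 (Tn x2 x3) (Tn y2 y3)).
rewrite (star_mid x2 x3 y2 y2 x3 y3).
rewrite star_braid_l star_braid_r !star_id /= !tensm_id !comp_idl !comp_idr.
rewrite -!tensm_idl; congr (_ ⊠ _).
rewrite tensm_idl -!comp_assoc; congr (_ ∘ _).
by have /= := star_nat (e := Tn x2 y1) (e' := Tn y1 x2) (braid X2 Y1)
  (star (Tn x3 y2) (Tn y2 x3) (braid X3 Y2) (Y3 ⊗ tunit)).
Qed.

Lemma interchange_counit_l X Y :
  lunit (X ⊗ Y) ∘ ((lunit tunit ⊠ idm _) ∘ interchange tunit X tunit Y)
  = lunit X ⊠ lunit Y.
Proof.
rewrite -!interchangeE; pose x := At X; pose y := At Y; pose i := I M.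
apply: (star_inj (Tn (Tn i x) (Tn i y)) (Tn x y)).
rewrite (star_comp (Tn i (Tn x y))) (star_comp (Tn (Tn i i) (Tn x y))).
rewrite !star_tens (star_lunit i) (star_lunit x) (star_lunit y) star_lunit.
rewrite (star_mid i x i i x y) (star_braid_1r x).
by rewrite !star_id /= !tensm_id !comp_idl.
Qed.

Lemma interchange_counit_r X Y :
  runit (X ⊗ Y) ∘ ((idm _ ⊠ lunit tunit) ∘ interchange X tunit Y tunit)
  = runit X ⊠ runit Y.
Proof.
rewrite -!interchangeE; pose x := At X; pose y := At Y; pose i := I M.
apply: (star_inj (Tn (Tn x i) (Tn y i)) (Tn x y)).
rewrite (star_comp (Tn (Tn x y) i)) (star_comp (Tn (Tn x y) (Tn i i))).
rewrite !star_tens (star_lunit i) (star_runit x) (star_runit y) star_runit.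
rewrite (star_mid x i y y i i) (star_braid_1l y).
by rewrite !star_id /= !tensm_id !comp_idl.
Qed.

Lemma interchange_unit_l X Y :
  (lunit X ⊠ lunit Y) ∘ (interchange tunit tunit X Y ∘ (lunit_inv tunit ⊠ idm _))
  = lunit (X ⊗ Y).
Proof.
rewrite -!interchangeE; pose x := At X; pose y := At Y; pose i := I M.
apply: (star_inj (Tn i (Tn x y)) (Tn x y)).
rewrite (star_comp (Tn (Tn i x) (Tn i y))) (star_comp (Tn (Tn i i) (Tn x y))).
rewrite !star_tens (star_lunit_inv i) (star_lunit x) (star_lunit y) star_lunit.
rewrite (star_mid i i x x i y) (star_braid_1l x).
by rewrite !star_id /= !tensm_id !comp_idl.
Qed.

Lemma interchange_unit_r X Y :
  (runit X ⊠ runit Y) ∘ (interchange X Y tunit tunit ∘ (idm _ ⊠ lunit_inv tunit))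
  = runit (X ⊗ Y).
Proof.
rewrite -!interchangeE; pose x := At X; pose y := At Y; pose i := I M.
apply: (star_inj (Tn (Tn x y) i) (Tn x y)).
rewrite (star_comp (Tn (Tn x i) (Tn y i))) (star_comp (Tn (Tn x y) (Tn i i))).
rewrite !star_tens (star_lunit_inv i) (star_runit x) (star_runit y) star_runit.
rewrite (star_mid x y i i y i) (star_braid_1r y).
by rewrite !star_id /= !tensm_id !comp_idl.
Qed.

End Interchange.

Section UnitObject.
Variable M : MonoidalCategory.

Lemma runit_tunit : runit (@tunit M) = lunit tunit.
Proof.
pose i := I M; apply: (star_inj (Tn i i) i).
by rewrite star_runit star_lunit.
Qed.

Lemma lunit_tunit_assoc :
  lunit (@tunit M) ∘ ((idm _ ⊠ lunit tunit) ∘ assoc _ _ _)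
  = lunit tunit ∘ (lunit tunit ⊠ idm _).
Proof. by rewrite triangle runit_tunit. Qed.

Lemma lunit_inv_tunit_assoc :
  assoc _ _ _ ∘ ((lunit_inv (@tunit M) ⊠ idm _) ∘ lunit_inv tunit)
  = (idm _ ⊠ lunit_inv tunit) ∘ lunit_inv tunit.
Proof.
pose i := I M; apply: (star_inj i (Tn i (Tn i i))).
rewrite (star_comp (Tn (Tn i i) i)) !(star_comp (Tn i i)).
by rewrite !star_tens star_assoc (star_lunit_inv i) !star_id !actm_id !comp_idl.
Qed.

End UnitObject.

Record Coalgebra (M : MonoidalCategory) := {
  carrier :> M;
  delta : hom carrier (carrier ⊗ carrier);
  eps : hom carrier tunit;
  coassoc : assoc _ _ _ ∘ ((delta ⊠ idm carrier) ∘ delta)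
            = (idm carrier ⊠ delta) ∘ delta;
  counit_l : lunit carrier ∘ ((eps ⊠ idm carrier) ∘ delta) = idm carrier;
  counit_r : runit carrier ∘ ((idm carrier ⊠ eps) ∘ delta) = idm carrier
}.

Arguments delta {M} c.
Arguments eps {M} c.

Record CoalgHom (M : MonoidalCategory) (C D : Coalgebra M) := {
  cmor :> hom C D;
  cmor_delta : delta D ∘ cmor = (cmor ⊠ cmor) ∘ delta C;
  cmor_eps : eps D ∘ cmor = eps C
}.

Lemma CoalgHom_eq (M : MonoidalCategory) (C D : Coalgebra M) (f g : CoalgHom C D) :
  cmor f = cmor g -> f = g.
Proof.
case: f g => [f df ef] [g dg eg] /= e; move: df ef; rewrite e => df ef.
by rewrite (proof_irrelevance _ df dg) (proof_irrelevance _ ef eg).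
Qed.

Section Coalg.
Variable M : BraidedCategory.
Implicit Types C D E : Coalgebra M.

Fact id_delta C : delta C ∘ idm C = (idm C ⊠ idm C) ∘ delta C.
Proof. by rewrite tensm_id comp_idl comp_idr. Qed.

Definition coalg_id C : CoalgHom C C :=
  {| cmor := idm C; cmor_delta := id_delta C; cmor_eps := comp_idr (eps C) |}.

Fact comp_delta C D E (g : CoalgHom D E) (f : CoalgHom C D) :
  delta E ∘ (g ∘ f) = ((g ∘ f) ⊠ (g ∘ f)) ∘ delta C.
Proof.
by rewrite tensm_comp -comp_assoc cmor_delta comp_assoc cmor_delta comp_assoc.
Qed.

Fact comp_eps C D E (g : CoalgHom D E) (f : CoalgHom C D) :
  eps E ∘ (g ∘ f) = eps C.
Proof. by rewrite -comp_assoc !cmor_eps. Qed.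

Definition coalg_comp C D E (g : CoalgHom D E) (f : CoalgHom C D) : CoalgHom C E :=
  {| cmor := g ∘ f; cmor_delta := comp_delta g f; cmor_eps := comp_eps g f |}.

Definition tens_delta C D : hom (C ⊗ D) ((C ⊗ D) ⊗ (C ⊗ D)) :=
  mid C (braid C D) D ∘ (delta C ⊠ delta D).

Definition tens_eps C D : hom (C ⊗ D) tunit := lunit tunit ∘ (eps C ⊠ eps D).

Fact tens_coassoc C D :
  assoc _ _ _ ∘ ((tens_delta C D ⊠ idm _) ∘ tens_delta C D)
  = (idm _ ⊠ tens_delta C D) ∘ tens_delta C D.
Proof.
have nat1 := interchange_nat (delta C) (idm C) (delta D) (idm D).
have nat2 := interchange_nat (idm C) (delta C) (idm D) (delta D).
rewrite tensm_id in nat1; rewrite tensm_id in nat2.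
rewrite /tens_delta !interchangeE tensm_idr tensm_idl !comp_assoc.
rewrite (comp_assoc_eq _ (esym nat1)) (comp_assoc_eq _ (esym nat2)) !comp_assoc.
rewrite -!tensm_comp -!coassoc !tensm_comp.
rewrite -(comp_assoc (interchange _ _ _ _ ⊠ _)) (comp_assoc_eq _ (interchange_coassoc _ _ _ _ _ _)).
by rewrite !comp_assoc.
Qed.

Fact tens_counit_l C D :
  lunit _ ∘ ((tens_eps C D ⊠ idm _) ∘ tens_delta C D) = idm _.
Proof.
have nat := interchange_nat (eps C) (idm C) (eps D) (idm D); rewrite tensm_id in nat.
rewrite /tens_eps /tens_delta !interchangeE tensm_idr !comp_assoc.
rewrite (comp_assoc_eq _ (esym nat)) !comp_assoc -tensm_comp.
rewrite -(comp_assoc (lunit _ ⊠ _)) -(comp_assoc (lunit _)) interchange_counit_l.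
by rewrite -tensm_comp !counit_l tensm_id.
Qed.

Fact tens_counit_r C D :
  runit _ ∘ ((idm _ ⊠ tens_eps C D) ∘ tens_delta C D) = idm _.
Proof.
have nat := interchange_nat (idm C) (eps C) (idm D) (eps D); rewrite tensm_id in nat.
rewrite /tens_eps /tens_delta !interchangeE tensm_idl !comp_assoc.
rewrite (comp_assoc_eq _ (esym nat)) !comp_assoc -tensm_comp.
rewrite -(comp_assoc (_ ⊠ lunit _)) -(comp_assoc (runit _)) interchange_counit_r.
by rewrite -tensm_comp !counit_r tensm_id.
Qed.

Definition coalg_tens C D : Coalgebra M :=
  {| carrier := C ⊗ D; delta := tens_delta C D; eps := tens_eps C D;
     coassoc := tens_coassoc C D; counit_l := tens_counit_l C D;
     counit_r := tens_counit_r C D |}.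

Fact tensm_delta C C' D D' (f : CoalgHom C C') (g : CoalgHom D D') :
  tens_delta C' D' ∘ (f ⊠ g) = ((f ⊠ g) ⊠ (f ⊠ g)) ∘ tens_delta C D.
Proof.
rewrite /tens_delta !interchangeE comp_assoc -tensm_comp !cmor_delta tensm_comp.
by rewrite -comp_assoc interchange_nat comp_assoc.
Qed.

Fact tensm_eps C C' D D' (f : CoalgHom C C') (g : CoalgHom D D') :
  tens_eps C' D' ∘ (f ⊠ g) = tens_eps C D.
Proof. by rewrite /tens_eps comp_assoc -tensm_comp !cmor_eps. Qed.

Definition coalg_tensm C C' D D' (f : CoalgHom C C') (g : CoalgHom D D') :
    CoalgHom (coalg_tens C D) (coalg_tens C' D') :=
  @Build_CoalgHom M (coalg_tens C D) (coalg_tens C' D') (f ⊠ g)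
    (tensm_delta f g) (tensm_eps f g).

Fact unit_counit_l : lunit (@tunit M) ∘ ((idm tunit ⊠ idm _) ∘ lunit_inv _) = idm _.
Proof. by rewrite tensm_id comp_idl lunit_invK. Qed.

Fact unit_counit_r : runit (@tunit M) ∘ ((idm _ ⊠ idm tunit) ∘ lunit_inv _) = idm _.
Proof. by rewrite tensm_id comp_idl runit_tunit lunit_invK. Qed.

Definition coalg_unit : Coalgebra M :=
  {| carrier := tunit; delta := lunit_inv tunit; eps := idm tunit;
     coassoc := lunit_inv_tunit_assoc M; counit_l := unit_counit_l;
     counit_r := unit_counit_r |}.

Fact inv_delta C D (f : CoalgHom C D) (g : hom D C) :
  g ∘ f = idm _ -> f ∘ g = idm _ -> delta C ∘ g = (g ⊠ g) ∘ delta D.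
Proof.
move=> gf fg; apply: (comp_can_r fg).
by rewrite !comp_assoc gf cmor_delta -comp_assoc -tensm_comp gf tensm_id comp_idl comp_idr.
Qed.

Fact inv_eps C D (f : CoalgHom C D) (g : hom D C) :
  f ∘ g = idm _ -> eps C ∘ g = eps D.
Proof. by move=> fg; rewrite -(cmor_eps f) comp_assoc fg comp_idr. Qed.

Definition coalg_inv C D (f : CoalgHom C D) (g : hom D C)
    (gf : g ∘ f = idm _) (fg : f ∘ g = idm _) : CoalgHom D C :=
  {| cmor := g; cmor_delta := inv_delta gf fg; cmor_eps := inv_eps fg |}.

Fact assoc_delta C D E :
  tens_delta C (coalg_tens D E) ∘ assoc C D E
  = (assoc C D E ⊠ assoc C D E) ∘ tens_delta (coalg_tens C D) E.
Proof.
rewrite /tens_delta /= /tens_delta !interchangeE.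
rewrite -[delta C]comp_idl -[delta E in RHS]comp_idl !tensm_comp !comp_assoc.
rewrite -assoc_nat -(comp_assoc (idm _ ⊠ interchange _ _ _ _)).
rewrite -(comp_assoc (interchange _ _ _ _)) -interchange_assoc.
by rewrite !comp_assoc -!tensm_comp !comp_idl.
Qed.

Fact assoc_eps C D E :
  tens_eps C (coalg_tens D E) ∘ assoc C D E = tens_eps (coalg_tens C D) E.
Proof.
rewrite /tens_eps /= /tens_eps -[eps C]comp_idl -[eps E in RHS]comp_idl.
rewrite !tensm_comp !comp_assoc -assoc_nat.
rewrite -(comp_assoc (idm _ ⊠ _)) -(comp_assoc (lunit _)) lunit_tunit_assoc.
by rewrite !comp_assoc comp_idl.
Qed.

Definition coalg_assoc C D E :
    CoalgHom (coalg_tens (coalg_tens C D) E) (coalg_tens C (coalg_tens D E)) :=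
  @Build_CoalgHom M (coalg_tens (coalg_tens C D) E) (coalg_tens C (coalg_tens D E))
    (assoc C D E) (assoc_delta C D E) (assoc_eps C D E).

Fact lunit_delta C :
  delta C ∘ lunit C = (lunit C ⊠ lunit C) ∘ tens_delta coalg_unit C.
Proof.
rewrite /tens_delta /= !interchangeE -lunit_nat.
rewrite -(interchange_unit_l C C) -[delta C in RHS]comp_idl.
by rewrite -[lunit_inv _ in RHS]comp_idr tensm_comp !comp_assoc.
Qed.

Fact lunit_eps C : eps C ∘ lunit C = tens_eps coalg_unit C.
Proof. by rewrite /tens_eps /= lunit_nat. Qed.

Definition coalg_lunit C : CoalgHom (coalg_tens coalg_unit C) C :=
  @Build_CoalgHom M (coalg_tens coalg_unit C) C (lunit C) (lunit_delta C) (lunit_eps C).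

Fact runit_delta C :
  delta C ∘ runit C = (runit C ⊠ runit C) ∘ tens_delta C coalg_unit.
Proof.
rewrite /tens_delta /= !interchangeE -runit_nat.
rewrite -(interchange_unit_r C C) -[delta C in RHS]comp_idl.
by rewrite -[lunit_inv _ in RHS]comp_idr tensm_comp !comp_assoc.
Qed.

Fact runit_eps C : eps C ∘ runit C = tens_eps C coalg_unit.
Proof. by rewrite /tens_eps /= -runit_tunit runit_nat. Qed.

Definition coalg_runit C : CoalgHom (coalg_tens C coalg_unit) C :=
  @Build_CoalgHom M (coalg_tens C coalg_unit) C (runit C) (runit_delta C) (runit_eps C).

Definition Coalg : MonoidalCategory.
Proof.
refine {|
  obj := Coalgebra M;
  hom := @CoalgHom M;
  idm := coalg_id;
  comp := coalg_comp;
  tens := coalg_tens;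
  tensm := coalg_tensm;
  tunit := coalg_unit;
  assoc := coalg_assoc;
  assoc_inv := fun C D E =>
    coalg_inv (f := coalg_assoc C D E) (assocK C D E) (assoc_invK C D E);
  lunit := coalg_lunit;
  lunit_inv := fun C => coalg_inv (f := coalg_lunit C) (lunitK C) (lunit_invK C);
  runit := coalg_runit;
  runit_inv := fun C => coalg_inv (f := coalg_runit C) (runitK C) (runit_invK C)
|}; intros; apply: CoalgHom_eq => /=.
- exact: comp_idl.
- exact: comp_idr.
- exact: comp_assoc.
- exact: tensm_id.
- exact: tensm_comp.
- exact: assocK.
- exact: assoc_invK.
- exact: assoc_nat.
- exact: lunitK.
- exact: lunit_invK.
- exact: lunit_nat.
- exact: runitK.
- exact: runit_invK.
- exact: runit_nat.
- exact: pentagon.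
- exact: triangle.
Defined.

End Coalg.

Arguments Coalg M : clear implicits.

(** [ehom x y] plays the role of [Hom(y, x)]. *)
Record EnrichedGraph (N : MonoidalCategory) (S : Type) := {
  ehom :> S -> S -> N;
  ecomp : forall x y z, hom (ehom x y ⊗ ehom y z) (ehom x z);
  eid : forall x, hom tunit (ehom x x)
}.

Arguments ecomp {N S} e x y z.
Arguments eid {N S} e x.

Record is_enriched_category (N : MonoidalCategory) (S : Type)
    (A : EnrichedGraph N S) : Prop := {
  ecomp_assoc : forall x y z t,
    ecomp A x z t ∘ (ecomp A x y z ⊠ idm (A z t))
    = ecomp A x y t ∘ ((idm (A x y) ⊠ ecomp A y z t) ∘ assoc _ _ _);
  ecomp_idl : forall x y, ecomp A x x y ∘ (eid A x ⊠ idm (A x y)) = lunit (A x y);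
  ecomp_idr : forall x y, ecomp A x y y ∘ (idm (A x y) ⊠ eid A y) = runit (A x y)
}.

Record EnrichedCategory (N : MonoidalCategory) (S : Type) := {
  egraph :> EnrichedGraph N S;
  egraphP : is_enriched_category egraph
}.

Definition underlying (M : BraidedCategory) (S : Type)
    (A : EnrichedGraph (Coalg M) S) : EnrichedGraph M S :=
  {| ehom := fun x y => carrier (A x y);
     ecomp := fun x y z => cmor (ecomp A x y z);
     eid := fun x => cmor (eid A x) |}.

Definition is_initial (M : MonoidalCategory) (X : M) : Prop :=
  forall Y : M, exists f : hom X Y, forall g : hom X Y, g = f.

(** This holds vacuously when there is no initial object. *)
Definition is_domain (M : MonoidalCategory) : Prop :=
  forall X Y : M, is_initial (X ⊗ Y) <-> is_initial X \/ is_initial Y.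

(** The universal property is carried as an operation, so that morphisms out of
    [P] can be named without a choice principle. *)
Record Coproduct (M : MonoidalCategory) (S : Type) (X : S -> M) (P : M)
    (s : forall i, hom (X i) P) := {
  cotuple : forall Y : M, (forall i, hom (X i) Y) -> hom P Y;
  cotuple_in : forall (Y : M) (f : forall i, hom (X i) Y) i, cotuple f ∘ s i = f i;
  cotuple_uniq : forall (Y : M) (f : forall i, hom (X i) Y) (h : hom P Y),
    (forall i, h ∘ s i = f i) -> h = cotuple f
}.

Arguments cotuple {M S X P s} c {Y} f.

Record SDistributive (M : MonoidalCategory) (S : Type) := {
  sum : (S -> M) -> M;
  sum_in : forall (X : S -> M) i, hom (X i) (sum X);
  sum_coprod : forall X : S -> M, Coproduct (sum_in X);
  sum_distl : forall (Y : M) (X : S -> M),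
    Coproduct (X := fun i => Y ⊗ X i) (fun i => idm Y ⊠ sum_in X i);
  sum_distr : forall (Y : M) (X : S -> M),
    Coproduct (X := fun i => X i ⊗ Y) (fun i => sum_in X i ⊠ idm Y)
}.

Arguments sum {M S} s X.
Arguments sum_in {M S} s X i.
Arguments sum_coprod {M S} s X.
Arguments sum_distl {M S} s Y X.
Arguments sum_distr {M S} s Y X.

Lemma cotuple_ext (M : MonoidalCategory) (S : Type) (X : S -> M) (P : M)
    (s : forall i, hom (X i) P) (c : Coproduct s) (Y : M) (f g : hom P Y) :
  (forall i, f ∘ s i = g ∘ s i) -> f = g.
Proof.
move=> e; rewrite (cotuple_uniq c (f := fun i => g ∘ s i) e).
by rewrite -(cotuple_uniq c (f := fun i => g ∘ s i) (h := g)).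
Qed.

Section Sum2.
Variables (M : MonoidalCategory) (S : Type) (D : SDistributive M S).
Variables (X Y : S -> M) (Z : M).

Definition cotuple2 (f : forall u v, hom (X u ⊗ Y v) Z) : hom (sum D X ⊗ sum D Y) Z :=
  cotuple (sum_distr D (sum D Y) X) (fun u => cotuple (sum_distl D (X u) Y) (f u)).

Lemma cotuple2_in f u v : cotuple2 f ∘ (sum_in D X u ⊠ sum_in D Y v) = f u v.
Proof.
by rewrite tensm_split -comp_assoc (cotuple_in (sum_distr D _ X))
  (cotuple_in (sum_distl D _ Y)).
Qed.

Lemma cotuple2_uniq f (h : hom (sum D X ⊗ sum D Y) Z) :
  (forall u v, h ∘ (sum_in D X u ⊠ sum_in D Y v) = f u v) -> h = cotuple2 f.
Proof.
move=> e; apply: (cotuple_ext (sum_distr D (sum D Y) X)) => u.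
apply: (cotuple_ext (sum_distl D (X u) Y)) => v.
by rewrite !comp_assoc -tensm_split e cotuple2_in.
Qed.

End Sum2.

Arguments cotuple2 {M S} D {X Y Z} f.

Section SumCoalg.
Variables (M : BraidedCategory) (S : Type) (D : SDistributive M S).
Variable C : S -> Coalgebra M.

Let P := sum_coprod D C.
Let s := sum_in D C.

Definition sum_delta : hom (sum D C) (sum D C ⊗ sum D C) :=
  cotuple P (fun i => (s i ⊠ s i) ∘ delta (C i)).

Definition sum_eps : hom (sum D C) tunit := cotuple P (fun i => eps (C i)).

Fact sum_delta_in i : sum_delta ∘ s i = (s i ⊠ s i) ∘ delta (C i).
Proof. exact: (cotuple_in P). Qed.

Fact sum_eps_in i : sum_eps ∘ s i = eps (C i).
Proof. exact: (cotuple_in P). Qed.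

Fact sum_coassoc :
  assoc _ _ _ ∘ ((sum_delta ⊠ idm _) ∘ sum_delta) = (idm _ ⊠ sum_delta) ∘ sum_delta.
Proof.
apply: (cotuple_ext P) => i; rewrite !comp_assoc sum_delta_in.
rewrite -!(comp_assoc (_ ⊠ _) (_ ⊠ _)) -!tensm_comp !comp_idl !sum_delta_in.
have -> : ((s i ⊠ s i) ∘ delta (C i)) ⊠ s i
    = ((s i ⊠ s i) ⊠ s i) ∘ (delta (C i) ⊠ idm _) by rewrite -tensm_comp comp_idr.
have -> : s i ⊠ ((s i ⊠ s i) ∘ delta (C i))
    = (s i ⊠ (s i ⊠ s i)) ∘ (idm _ ⊠ delta (C i)) by rewrite -tensm_comp comp_idr.
by rewrite !comp_assoc -coassoc -[LHS]comp_assoc assoc_nat comp_assoc.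
Qed.

Fact sum_counit_l : lunit _ ∘ ((sum_eps ⊠ idm _) ∘ sum_delta) = idm _.
Proof.
apply: (cotuple_ext P) => i; rewrite !comp_assoc sum_delta_in comp_idl.
rewrite -(comp_assoc (_ ⊠ _) (_ ⊠ _)) -tensm_comp comp_idl sum_eps_in.
have -> : eps (C i) ⊠ s i = (idm _ ⊠ s i) ∘ (eps (C i) ⊠ idm _).
  by rewrite -tensm_comp comp_idl comp_idr.
rewrite -comp_assoc -(comp_assoc (lunit _)) lunit_nat.
by rewrite !comp_assoc counit_l comp_idr.
Qed.

Fact sum_counit_r : runit _ ∘ ((idm _ ⊠ sum_eps) ∘ sum_delta) = idm _.
Proof.
apply: (cotuple_ext P) => i; rewrite !comp_assoc sum_delta_in comp_idl.
rewrite -(comp_assoc (_ ⊠ _) (_ ⊠ _)) -tensm_comp comp_idl sum_eps_in.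
have -> : s i ⊠ eps (C i) = (s i ⊠ idm _) ∘ (idm _ ⊠ eps (C i)).
  by rewrite -tensm_comp comp_idl comp_idr.
rewrite -comp_assoc -(comp_assoc (runit _)) runit_nat.
by rewrite !comp_assoc counit_r comp_idr.
Qed.

Definition sum_coalg : Coalgebra M :=
  {| carrier := sum D C; delta := sum_delta; eps := sum_eps;
     coassoc := sum_coassoc; counit_l := sum_counit_l; counit_r := sum_counit_r |}.

Definition sum_coalg_in i : CoalgHom (C i) sum_coalg :=
  @Build_CoalgHom M (C i) sum_coalg (s i) (sum_delta_in i) (sum_eps_in i).

Lemma sum_coalg_uniq (d : hom (sum D C) (sum D C ⊗ sum D C)) (e : hom (sum D C) tunit) :
  (forall i, d ∘ s i = (s i ⊠ s i) ∘ delta (C i)) ->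
  (forall i, e ∘ s i = eps (C i)) ->
  d = delta sum_coalg /\ e = eps sum_coalg.
Proof. by move=> hd he; split; apply: (cotuple_uniq P). Qed.

End SumCoalg.

(** The equalities between values of [mbar] in a matched pair are propositional:
    both sides of the identities stated along them live in hom-objects that are
    identified by these morphisms. *)
Definition cast_l (M : MonoidalCategory) (S : Type) (H : S -> S -> M) (y x x' : S)
    (e : x = x') : hom (H x y) (H x' y) :=
  match e in _ = u return hom (H x y) (H u y) with eq_refl => idm _ end.

Definition cast_r (M : MonoidalCategory) (S : Type) (H : S -> S -> M) (x y y' : S)
    (e : y = y') : hom (H x y) (H x y') :=
  match e in _ = u return hom (H x y) (H x u) with eq_refl => idm _ end.

Section MatchedPair.
Variables (M : BraidedCategory) (S : Type) (A B : EnrichedCategory (Coalg M) S).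

Local Notation uA := (underlying A).
Local Notation uB := (underlying B).

Record MatchedPairData := {
  mbar : S -> S -> S -> S;
  mright : forall x y z : S, hom (B x y ⊗ A y z) (A x (mbar x y z));
  mleft : forall x y z : S, hom (B x y ⊗ A y z) (B (mbar x y z) z)
}.

Variable P : MatchedPairData.

Local Notation "`| x , y , z |" := (mbar P x y z) (format "`| x ,  y ,  z |").

(** [act_r] is the action written ▷ and [act_l] the action written ◁, as morphisms
    of [M]. *)
Definition act_r x y z : hom (uB x y ⊗ uA y z) (uA x `|x, y, z|) := cmor (mright P x y z).
Definition act_l x y z : hom (uB x y ⊗ uA y z) (uB `|x, y, z| z) := cmor (mleft P x y z).

Definition rtilde x y z : hom (uB x y ⊗ uA y z) (uA x `|x, y, z| ⊗ uB `|x, y, z| z) :=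
  (act_r x y z ⊠ act_l x y z) ∘ tens_delta (B x y) (A y z).

(** The unit constraints surrounding [eps _ ⊠ eid _ _] and [eid _ _ ⊠ eps _] below
    identify the source [tunit ⊗ X] or [X ⊗ tunit] with [X ⊗ tunit] or [tunit ⊗ X]. *)
Record is_matched_pair : Prop := {
  mp_braid : forall x y z,
    (act_l x y z ⊠ act_r x y z) ∘ tens_delta (B x y) (A y z)
    = braid _ _ ∘ ((act_r x y z ⊠ act_l x y z) ∘ tens_delta (B x y) (A y z));
  mp_initial : forall x y z,
    ~ is_initial (uB x y ⊗ uA y z) ->
    ~ is_initial (uA x `|x, y, z| ⊗ uB `|x, y, z| z);
  mp_comp_B : forall x y z t,
    ~ is_initial ((uB x y ⊗ uB y z) ⊗ uA z t) ->
    exists e : `|x, y, `|y, z, t| | = `|x, z, t|,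
      act_l x z t ∘ (ecomp uB x y z ⊠ idm (uA z t))
      = ecomp uB `|x, z, t| `|y, z, t| t
        ∘ (((cast_l uB `|y, z, t| e ∘ act_l x y `|y, z, t|) ⊠ idm (uB `|y, z, t| t))
        ∘ (assoc_inv _ _ _
        ∘ ((idm (uB x y) ⊠ (act_r y z t ⊠ act_l y z t))
        ∘ ((idm (uB x y) ⊠ tens_delta (B y z) (A z t))
        ∘ assoc _ _ _))))
      /\ act_r x z t ∘ (ecomp uB x y z ⊠ idm (uA z t))
      = cast_r uA x e
        ∘ (act_r x y `|y, z, t| ∘ ((idm (uB x y) ⊠ act_r y z t) ∘ assoc _ _ _));
  mp_comp_A : forall x y z t,
    ~ is_initial (uB x y ⊗ (uA y z ⊗ uA z t)) ->
    exists e : `| `|x, y, z|, z, t| = `|x, y, t|,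
      act_r x y t ∘ (idm (uB x y) ⊠ ecomp uA y z t)
      = ecomp uA x `|x, y, z| `|x, y, t|
        ∘ ((idm (uA x `|x, y, z|) ⊠ (cast_r uA `|x, y, z| e ∘ act_r `|x, y, z| z t))
        ∘ (assoc _ _ _
        ∘ (((act_r x y z ⊠ act_l x y z) ⊠ idm (uA z t))
        ∘ ((tens_delta (B x y) (A y z) ⊠ idm (uA z t))
        ∘ assoc_inv _ _ _))))
      /\ act_l x y t ∘ (idm (uB x y) ⊠ ecomp uA y z t)
      = cast_l uB t e
        ∘ (act_l `|x, y, z| z t ∘ ((act_l x y z ⊠ idm (uA z t)) ∘ assoc_inv _ _ _));
  mp_unit_B : forall x y,
    ~ is_initial (uA x y) ->
    exists e : `|x, x, y| = y,
      cast_l uB y e ∘ (act_l x x y ∘ (eid uB x ⊠ idm (uA x y)))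
      = lunit _ ∘ ((eps (A x y) ⊠ eid uB y) ∘ (runit_inv _ ∘ lunit _))
      /\ cast_r uA x e ∘ (act_r x x y ∘ (eid uB x ⊠ idm (uA x y))) = lunit _;
  mp_unit_A : forall x y,
    ~ is_initial (uB x y) ->
    exists e : `|x, y, y| = x,
      cast_l uB y e ∘ (act_l x y y ∘ (idm (uB x y) ⊠ eid uA y)) = runit _
      /\ cast_r uA x e ∘ (act_r x y y ∘ (idm (uB x y) ⊠ eid uA y))
      = runit _ ∘ ((eid uA x ⊠ eps (B x y)) ∘ (lunit_inv _ ∘ runit _))
}.

End MatchedPair.

Record MatchedPair (M : BraidedCategory) (S : Type)
    (A B : EnrichedCategory (Coalg M) S) := {
  mpdata :> MatchedPairData A B;
  mpdataP : is_matched_pair mpdata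
}.

Section Bicrossed.
Variables (M : BraidedCategory) (S : Type) (D : SDistributive M S).
Variables (A B : EnrichedCategory (Coalg M) S) (P : MatchedPair A B).

Local Notation uA := (underlying A).
Local Notation uB := (underlying B).

Definition bicrossed_in x y (u : S) :
    hom (uA x u ⊗ uB u y) (sum D (fun u => uA x u ⊗ uB u y)) :=
  sum_in D (fun u => uA x u ⊗ uB u y) u.

Definition bicrossed : EnrichedGraph M S := {|
  ehom := fun x y => sum D (fun u => uA x u ⊗ uB u y);
  ecomp := fun x y z => cotuple2 D (fun u v =>
    bicrossed_in x z (mbar P u y v)
    ∘ ((ecomp uA x u (mbar P u y v) ⊠ ecomp uB (mbar P u y v) v z)
    ∘ mid (uA x u) (rtilde P u y v) (uB v z)));
  eid := fun x => bicrossed_in x x x ∘ ((eid uA x ⊠ eid uB x) ∘ lunit_inv tunit)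
|}.

(** The carrier is the hom-object of [bicrossed]; the structure is the unique one
    making the inclusions coalgebra morphisms ([sum_coalg_in], [sum_coalg_uniq]). *)
Definition bicrossed_coalg (x y : S) : Coalg M :=
  sum_coalg D (fun u => coalg_tens (A x u) (B u y)).

End Bicrossed.

Arguments bicrossed {M S} D {A B} P.
Arguments bicrossed_coalg {M S} D A B x y.

(* Main.v *)
(** Let R be the twisting map (▷ ⊗ ◁) ∘ Δ.  By coassociativity the axioms (ii)-(v) of
    a matched pair become the statement that R commutes with the compositions and the
    identities of A and B, as for a distributive law, and the braiding axiom says that R
    is a coalgebra morphism.  Composition in the bicrossed product is built from R and
    the compositions of A and B, hence is associative and unital on every summand that
    is not initial; on initial summands there is nothing to prove.  It is a coalgebra
    morphism because it is one on every summand. *)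

From Stdlib Require Import ssreflect ssrfun ProofIrrelevance Classical.
Require Import Defs.

Set Implicit Arguments.
Unset Strict Implicit.
Unset Printing Implicit Defensive.
Local Open Scope cat_scope.

(** * Tactics removing the structural isomorphisms *)

(** These tactics reify the bracketing of the objects in an equation of morphisms and
    transport it along [star], so that all the structural isomorphisms disappear;
    [strict_at h T] does so for a hypothesis, with tail [T]. *)
Ltac tree_of X :=
  lazymatch X with
  | ?Y ⊗ ?Z => let a := tree_of Y in let b := tree_of Z in constr:(Tn a b)
  | @tunit ?M => constr:(@I M)
  | _ => constr:(At X)
  end.

Ltac strict_comp :=
  repeat match goal with
  | |- context [@star ?M ?e ?e'' (@comp _ _ ?Y _ ?g ?f) ?T] =>
      let e' := tree_of Y in rewrite (@star_comp M e' e e'' g f T)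
  end.

Ltac strictify :=
  rewrite /mid;
  repeat (progress (strict_comp;
    rewrite ?star_assoc ?star_assoc_inv ?star_lunit ?star_lunit_inv
      ?star_runit ?star_runit_inv ?star_id ?star_tens ?actm_id ?comp_idl ?comp_idr));
  rewrite /= ?tensm_idl ?tensm_id ?comp_idl ?comp_idr ?comp_assoc.

Ltac strict :=
  lazymatch goal with |- @eq (@hom _ ?X ?Y) _ _ =>
    let a := tree_of X in let b := tree_of Y in apply: (star_inj a b) end;
  strictify.

Ltac strict_at h T :=
  lazymatch type of h with @eq (@hom ?M ?X ?Y) ?f ?g =>
    let a := tree_of X in let b := tree_of Y in
    generalize (f_equal (fun k => star a b k T) h); strictify end.

Ltac nat_of f :=
  lazymatch type of f with @hom ?M ?X ?Y =>
    let a := tree_of X in let b := tree_of Y in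
    generalize (@star_nat M a b f); rewrite /= end.

(** * Twisting maps in a monoidal category *)

Section Twist.
Variable M : MonoidalCategory.

Lemma tensm_idl_comp (X Y Y' Y'' Z : M) (g : hom Y' Y'') (f : hom Y Y') (h : hom Z (X ⊗ Y)) :
  (idm X ⊠ g) ∘ ((idm X ⊠ f) ∘ h) = (idm X ⊠ (g ∘ f)) ∘ h.
Proof. by rewrite tensm_idl comp_assoc. Qed.

(** [X_i], [Y_i] are the factors of the i-th summand; [R12] and [R123] are the twisting
    maps met when composing from the left, [R23] and [R1_23] from the right, and [R] is
    the one common to both, that exchanges [Y1'] and [X3']. *)
Lemma twist_assoc
    (X1 X2 X3 Y1 Y2 Y3 X2' Y1' X12 Y12 X3'' Y12' X3' Y2' X23 Y23 X23' Y1'' X Y : M)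
    (R12 : hom (Y1 ⊗ X2) (X2' ⊗ Y1'))
    (a12 : hom (X1 ⊗ X2') X12) (b12 : hom (Y1' ⊗ Y2) Y12)
    (R123 : hom (Y12 ⊗ X3) (X3'' ⊗ Y12'))
    (a12_3 : hom (X12 ⊗ X3'') X) (b12_3 : hom (Y12' ⊗ Y3) Y)
    (R23 : hom (Y2 ⊗ X3) (X3' ⊗ Y2'))
    (a23 : hom (X2 ⊗ X3') X23) (b23 : hom (Y2' ⊗ Y3) Y23)
    (R1_23 : hom (Y1 ⊗ X23) (X23' ⊗ Y1''))
    (a1_23 : hom (X1 ⊗ X23') X) (b1_23 : hom (Y1'' ⊗ Y23) Y)
    (R : hom (Y1' ⊗ X3') (X3'' ⊗ Y1''))
    (a : hom (X2' ⊗ X3'') X23') (b : hom (Y1'' ⊗ Y2') Y12') :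
  R123 ∘ (b12 ⊠ idm X3)
  = (idm X3'' ⊠ b) ∘ (assoc _ _ _ ∘ ((R ⊠ idm Y2')
    ∘ (assoc_inv _ _ _ ∘ ((idm Y1' ⊠ R23) ∘ assoc _ _ _)))) ->
  R1_23 ∘ (idm Y1 ⊠ a23)
  = (a ⊠ idm Y1'') ∘ (assoc_inv _ _ _ ∘ ((idm X2' ⊠ R)
    ∘ (assoc _ _ _ ∘ ((R12 ⊠ idm X3') ∘ assoc_inv _ _ _)))) ->
  a12_3 ∘ (a12 ⊠ idm X3'') = a1_23 ∘ ((idm X1 ⊠ a) ∘ assoc _ _ _) ->
  b12_3 ∘ (b ⊠ idm Y3) = b1_23 ∘ ((idm Y1'' ⊠ b23) ∘ assoc _ _ _) ->
  ((a12_3 ⊠ b12_3) ∘ mid X12 R123 Y3)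
  ∘ (((a12 ⊠ b12) ∘ mid X1 R12 Y2) ⊠ idm (X3 ⊗ Y3))
  = ((a1_23 ⊠ b1_23) ∘ mid X1 R1_23 Y23)
    ∘ ((idm (X1 ⊗ Y1) ⊠ ((a23 ⊠ b23) ∘ mid X2 R23 Y3)) ∘ assoc _ _ _).
Proof.
move=> h1 h2 h3 h4.
(* Naturality of [star] is the interchange law: a map on the leading factors slides past any map on
   the tail. *)
nat_of a12 => n1; nat_of a => n2; nat_of R => n3; nat_of R12 => n4.
nat_of a23 => n5; nat_of R1_23 => n6.
strict_at h1 (Y3 ⊗ tunit) => {}h1.
strict_at h2 (Y2' ⊗ (Y3 ⊗ tunit)) => {}h2.
strict_at h3 (Y ⊗ tunit) => {}h3.
strict_at h4 (@tunit M) => {}h4.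
strict.
(* On the left [a12] slides out of the way, so that [h1] and then [h4] apply, and back next to
   [a12_3] for [h3]. *)
rewrite (comp_assoc_eq _ (n1 _ _ _)) !comp_assoc.
rewrite !tensm_idl_comp !comp_assoc h1.
rewrite (tensm_idl_comp (X := X3'')) h4.
rewrite (comp_assoc_eq _ (esym (n1 _ _ _))) !comp_assoc (comp_assoc_eq _ h3) !comp_assoc.
congr (_ ∘ _); rewrite -!tensm_idl; congr (_ ⊠ _).
(* On the right [b23] slides past [a23] and [R1_23], which then meet, so that [h2] applies. *)
rewrite n5 (tensm_idl _ (idm X23 ⊠ _)) (comp_assoc_eq _ (n6 _ _ _)) !comp_assoc.
rewrite (comp_assoc_eq _ h2) !comp_assoc n4 !tensm_idl !comp_assoc.
by rewrite !(comp_assoc_eq _ (n2 _ _ _)) !comp_assoc (comp_assoc_eq _ (n2 _ _ _)) !comp_assoc.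
Qed.

(** [R] carries the unit [j] across [X], where it becomes [k] and is absorbed by [b], while [a]
    absorbs [i]. *)
Lemma twist_unit_l (X0 Y0 X Y1 Y : M)
  (R : hom (Y0 ⊗ X) (X ⊗ Y1)) (a : hom (X0 ⊗ X) X) (b : hom (Y1 ⊗ Y) Y)
  (i : hom tunit X0) (j : hom tunit Y0) (k : hom tunit Y1) :
  R ∘ (j ⊠ idm X) = (idm X ⊠ k) ∘ (runit_inv X ∘ lunit X) ->
  a ∘ (i ⊠ idm X) = lunit X ->
  b ∘ (k ⊠ idm Y) = lunit Y ->
  ((a ⊠ b) ∘ mid X0 R Y) ∘ (((i ⊠ j) ∘ lunit_inv tunit) ⊠ idm (X ⊗ Y)) = lunit (X ⊗ Y).
Proof.
move=> h1 h2 h3; nat_of i => n.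
strict_at h1 (Y ⊗ tunit) => {}h1.
strict_at h2 (Y ⊗ tunit) => {}h2.
strict_at h3 (@tunit M) => {}h3.
strict.
rewrite n !tensm_idl_comp !comp_assoc h1 -tensm_idl h3 !tensm_id comp_idl.
exact: h2.
Qed.

Lemma twist_unit_r (X0 Y0 X X1 Y : M)
  (R : hom (Y ⊗ X0) (X1 ⊗ Y)) (a : hom (X ⊗ X1) X) (b : hom (Y ⊗ Y0) Y)
  (i : hom tunit X0) (j : hom tunit Y0) (k : hom tunit X1) :
  R ∘ (idm Y ⊠ i) = (k ⊠ idm Y) ∘ (lunit_inv Y ∘ runit Y) ->
  a ∘ (idm X ⊠ k) = runit X ->
  b ∘ (idm Y ⊠ j) = runit Y ->
  ((a ⊠ b) ∘ mid X R Y0) ∘ (idm (X ⊗ Y) ⊠ ((i ⊠ j) ∘ lunit_inv tunit)) = runit (X ⊗ Y).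
Proof.
move=> h1 h2 h3; nat_of k => n.
strict_at h1 (Y0 ⊗ tunit) => {}h1.
strict_at h2 (Y ⊗ tunit) => {}h2.
strict_at h3 (@tunit M) => {}h3.
strict.
rewrite -!tensm_idl (tensm_idl Y) (comp_assoc_eq _ h1) n.
by rewrite tensm_idl_comp h3 tensm_id comp_idl h2.
Qed.
End Twist.

(** * Tensor products of coalgebras and pairs of morphisms out of them *)

Section CoalgebraCalculus.
Variable M : BraidedCategory.
Implicit Types C D E : Coalgebra M.

Lemma interchange_assoc_l (X X' Y Y' Z : M) :
  (idm (X ⊗ Y) ⊠ assoc_inv X' Y' Z) ∘ interchange X X' Y (Y' ⊗ Z)
  = assoc _ _ _ ∘ ((interchange X X' Y Y' ⊠ idm Z)
    ∘ (assoc_inv _ _ _ ∘ (idm (X ⊗ X') ⊠ assoc_inv _ _ _))).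
Proof. by rewrite -!interchangeE; strict. Qed.

Lemma interchange_assoc_r (X Y Y' Z Z' : M) :
  (assoc X Y Z ⊠ idm (Y' ⊗ Z')) ∘ interchange (X ⊗ Y) Y' Z Z'
  = assoc_inv _ _ _ ∘ ((idm X ⊠ interchange Y Y' Z Z')
    ∘ (assoc _ _ _ ∘ (assoc _ _ _ ⊠ idm (Z ⊗ Z')))).
Proof. by rewrite -!interchangeE; strict. Qed.

Lemma tens_deltaE C D : tens_delta C D = interchange C C D D ∘ (delta C ⊠ delta D).
Proof. by rewrite /tens_delta interchangeE. Qed.

(** Coaction on the right factor makes [X ⊗ C] a right [C]-comodule; by coassociativity of [C] its
    comultiplication is colinear. *)
Lemma tens_delta_idl (X C : Coalgebra M) :
  (idm (X ⊗ C) ⊠ (assoc_inv X C C ∘ (idm X ⊠ delta C))) ∘ tens_delta X C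
  = assoc _ _ _ ∘ ((tens_delta X C ⊠ idm C) ∘ (assoc_inv X C C ∘ (idm X ⊠ delta C))).
Proof.
rewrite !tens_deltaE tensm_idl !comp_assoc.
have := interchange_nat (idm X) (idm X) (idm C) (delta C).
rewrite !tensm_id => nat.
rewrite (comp_assoc_eq _ (esym nat)) !comp_assoc -tensm_comp.
rewrite (comp_assoc_eq _ (interchange_assoc_l _ _ _ _ _)) !comp_assoc.
rewrite tensm_idr !comp_assoc ?tensm_id ?comp_idl.
rewrite (comp_assoc_eq _ (esym (assoc_inv_nat (delta X) _ _))) !comp_assoc -!tensm_comp -coassoc.
by rewrite -(comp_assoc (assoc_inv _ _ _)) assocK !comp_idl comp_idr.
Qed.

Lemma tens_delta_idr (C X : Coalgebra M) :
  ((assoc C C X ∘ (delta C ⊠ idm X)) ⊠ idm (C ⊗ X)) ∘ tens_delta C X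
  = assoc_inv _ _ _ ∘ ((idm C ⊠ tens_delta C X) ∘ (assoc C C X ∘ (delta C ⊠ idm X))).
Proof.
rewrite !tens_deltaE tensm_idr !comp_assoc.
have := interchange_nat (delta C) (idm C) (idm X) (idm X).
rewrite !tensm_id => nat.
rewrite (comp_assoc_eq _ (esym nat)) !comp_assoc -tensm_comp.
rewrite (comp_assoc_eq _ (interchange_assoc_r _ _ _ _ _)) !comp_assoc.
rewrite tensm_idl !comp_assoc ?tensm_id ?comp_idl.
rewrite (comp_assoc_eq _ (esym (assoc_nat _ _ (delta X)))) !comp_assoc -!tensm_comp coassoc.
by rewrite !comp_idl comp_idr.
Qed.

(** By colinearity, the duplication of [C] inside the second component can be performed first; since
    [r] preserves comultiplication, it then passes through [tens_delta X D]. *)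
Lemma tens_delta_natl (X C D : Coalgebra M) (E F G H : M) (r : CoalgHom C D) (l : hom C E)
    (f : hom (X ⊗ D) F) (g : hom (X ⊗ D) G) (k : hom (G ⊗ E) H) :
  ((f ∘ (idm X ⊠ r)) ⊠ (k ∘ ((g ⊠ idm E) ∘ (assoc_inv _ _ _
     ∘ ((idm X ⊠ (r ⊠ l)) ∘ (idm X ⊠ delta C)))))) ∘ tens_delta X C
  = (idm F ⊠ k) ∘ (assoc _ _ _ ∘ ((((f ⊠ g) ∘ tens_delta X D) ⊠ idm E)
     ∘ (assoc_inv _ _ _ ∘ (idm X ⊠ ((r ⊠ l) ∘ delta C))))).
Proof.
have e : ((f ⊠ g) ∘ tens_delta X D) ∘ (idm X ⊠ r)
    = ((f ∘ (idm X ⊠ r)) ⊠ (g ∘ (idm X ⊠ r))) ∘ tens_delta X C.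
  by rewrite comp_assoc (tensm_delta (coalg_id X) r) tensm_comp comp_assoc.
rewrite tensm_idl !(comp_assoc_eq _ (assoc_inv_nat _ _ _)) !comp_assoc.
rewrite -!(comp_assoc (_ ⊠ idm E)) -!tensm_comp e !comp_idl.
rewrite -{2}[l]comp_idr (tensm_comp (_ ⊠ _)) !comp_assoc.
rewrite (comp_assoc_eq _ (assoc_nat _ _ _)) !comp_assoc.
rewrite -tens_delta_idl -!comp_assoc -!tensm_comp comp_idl comp_idr.
by rewrite !comp_assoc.
Qed.

Lemma tens_delta_natr (C D X : Coalgebra M) (E F G H : M) (r : hom C E) (l : CoalgHom C D)
    (f : hom (D ⊗ X) F) (g : hom (D ⊗ X) G) (k : hom (E ⊗ F) H) :
  ((k ∘ ((idm E ⊠ f) ∘ (assoc _ _ _ ∘ (((r ⊠ l) ⊠ idm X) ∘ (delta C ⊠ idm X)))))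
     ⊠ (g ∘ (l ⊠ idm X))) ∘ tens_delta C X
  = (k ⊠ idm G) ∘ (assoc_inv _ _ _ ∘ ((idm E ⊠ ((f ⊠ g) ∘ tens_delta D X))
     ∘ (assoc _ _ _ ∘ (((r ⊠ l) ∘ delta C) ⊠ idm X)))).
Proof.
have e : ((f ⊠ g) ∘ tens_delta D X) ∘ (l ⊠ idm X)
    = ((f ∘ (l ⊠ idm X)) ⊠ (g ∘ (l ⊠ idm X))) ∘ tens_delta C X.
  by rewrite comp_assoc (tensm_delta l (coalg_id X)) tensm_comp comp_assoc.
rewrite tensm_idr !(comp_assoc_eq _ (assoc_nat _ _ _)) !comp_assoc.
rewrite -!(comp_assoc (idm E ⊠ _)) -!tensm_comp e !comp_idl.
rewrite -{2}[r]comp_idr (tensm_comp _ _ (_ ⊠ _)) !comp_assoc.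
rewrite (comp_assoc_eq _ (assoc_inv_nat _ _ _)) !comp_assoc.
rewrite -tens_delta_idr -!comp_assoc -!tensm_comp comp_idl comp_idr.
by rewrite !comp_assoc.
Qed.

(** The surrounding constraints cancel because the left and right ones agree on the unit object. *)
Lemma eps_unit_l C (X : M) (u : hom tunit X) :
  lunit _ ∘ ((eps C ⊠ u) ∘ runit_inv C) = u ∘ eps C.
Proof.
rewrite -[eps C]comp_idl -[u]comp_idr tensm_comp comp_idl comp_idr !comp_assoc.
rewrite (comp_assoc_eq _ (lunit_nat u)) -runit_tunit !comp_assoc.
by rewrite (comp_assoc_eq _ (runit_nat _)) !comp_assoc runit_invK comp_idr.
Qed.

Lemma eps_unit_r C (X : M) (u : hom tunit X) :
  runit _ ∘ ((u ⊠ eps C) ∘ lunit_inv C) = u ∘ eps C.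
Proof.
rewrite -[eps C]comp_idl -[u]comp_idr tensm_comp comp_idl comp_idr !comp_assoc.
rewrite (comp_assoc_eq _ (runit_nat u)) runit_tunit !comp_assoc.
by rewrite (comp_assoc_eq _ (lunit_nat _)) !comp_assoc lunit_invK comp_idr.
Qed.

(** Coassociativity lets the last duplication act on the middle factor, so that the two inner copies
    come from a single one. *)
Lemma delta_delta C : (delta C ⊠ delta C) ∘ delta C = assoc_inv _ _ _
    ∘ ((idm C ⊠ (assoc _ _ _ ∘ ((delta C ⊠ idm C) ∘ delta C))) ∘ delta C).
Proof.
rewrite tensm_split tensm_swap coassoc tensm_idl !comp_assoc -coassoc.
rewrite (comp_assoc_eq _ (assoc_inv_nat _ _ _)) !comp_assoc.
by rewrite -[X in _ = _ ∘ X]comp_assoc assocK comp_idl tensm_id.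
Qed.

(** Comultiplying in [D ⊗ E] braids the two inner of four copies of [C], and the hypothesis undoes
    this braiding. With ▷ and ◁ for [f] and [g], this makes [rtilde] comultiplicative. *)
Lemma delta_pair C (D E : Coalgebra M) (f : CoalgHom C D) (g : CoalgHom C E) :
  (g ⊠ f) ∘ delta C = braid D E ∘ ((f ⊠ g) ∘ delta C) ->
  tens_delta D E ∘ ((f ⊠ g) ∘ delta C)
  = (((f ⊠ g) ∘ delta C) ⊠ ((f ⊠ g) ∘ delta C)) ∘ delta C.
Proof.
move=> gf.
(* Both sides of the goal have the form [(f ⊗ k ⊗ g) ∘ Δ^4] with [k] applied to the two middle
   factors, and differ in [k] only. *)
have four (k : hom (C ⊗ C) (E ⊗ D)) :
    assoc_inv D E (D ⊗ E) ∘ ((f ⊠ (assoc E D E ∘ (((k ∘ delta C) ⊠ g) ∘ delta C))) ∘ delta C)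
    = (assoc_inv _ _ _ ∘ ((f ⊠ (assoc E D E ∘ ((k ⊠ g) ∘ assoc_inv _ _ _))) ∘ assoc _ _ _))
      ∘ ((delta C ⊠ delta C) ∘ delta C).
  rewrite delta_delta.
  rewrite !comp_assoc (comp_assoc_eq _ (assoc_invK _ _ _)) comp_idl.
  rewrite -(comp_assoc (f ⊠ _)) -tensm_comp comp_idr !comp_assoc.
  rewrite (comp_assoc_eq _ (assocK _ _ _)) comp_idl -(comp_assoc (k ⊠ g)) -tensm_comp.
  by rewrite comp_idr.
have four_mid : assoc_inv _ _ _ ∘ ((f ⊠ (assoc E D E ∘ (((braid D E ∘ (f ⊠ g)) ⊠ g)
    ∘ assoc_inv _ _ _))) ∘ assoc _ _ _) = mid D (braid D E) E ∘ ((f ⊠ f) ⊠ (g ⊠ g)).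
  rewrite /mid !comp_assoc assoc_nat -(comp_assoc (idm D ⊠ _)) -tensm_comp comp_idl.
  by rewrite !comp_assoc assoc_inv_nat -(comp_assoc (_ ⊠ idm E)) -tensm_comp comp_idl.
have four_id : assoc_inv _ _ _ ∘ ((f ⊠ (assoc E D E ∘ (((g ⊠ f) ⊠ g)
    ∘ assoc_inv _ _ _))) ∘ assoc _ _ _) = (f ⊠ g) ⊠ (f ⊠ g).
  rewrite -(comp_assoc (assoc _ _ _)) assoc_nat comp_assoc assoc_invK comp_idr.
  by rewrite -comp_assoc assoc_inv_nat comp_assoc assocK comp_idr.
(* By [gf] the choices [g ⊠ f] and [braid D E ∘ (f ⊠ g)] of [k] agree after [delta C]; the first
   gives the right-hand side, the second the left. *)
have := four (g ⊠ f); rewrite gf -(comp_assoc (braid D E)) four four_mid four_id => e.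
rewrite [in RHS]tensm_comp [in RHS]comp_assoc -e /tens_delta !comp_assoc.
rewrite -!(comp_assoc (delta D ⊠ _)).
by rewrite -!tensm_comp !cmor_delta tensm_comp !comp_assoc.
Qed.

Lemma eps_pair C (D E : Coalgebra M) (f : CoalgHom C D) (g : CoalgHom C E) :
  tens_eps D E ∘ ((f ⊠ g) ∘ delta C) = eps C.
Proof.
rewrite /tens_eps comp_assoc -(comp_assoc (eps D ⊠ _)) -tensm_comp !cmor_eps.
rewrite tensm_split tensm_swap !comp_assoc (comp_assoc_eq _ (lunit_nat _)) !comp_assoc.
by rewrite counit_l comp_idr.
Qed.

(** The hypotheses have the shape of axiom (ii). As [m] is a coalgebra morphism, duplication can
    precede it, and [tens_delta_natl] reassembles the two components into twisting maps. *)
Lemma twist_comp_l (X Y Z W D : Coalgebra M) (E F G H : M)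
    (m : CoalgHom (coalg_tens X Y) W) (r : CoalgHom (coalg_tens Y Z) D)
    (l : hom (Y ⊗ Z) E) (f : hom (X ⊗ D) F) (g : hom (X ⊗ D) G) (k : hom (G ⊗ E) H)
    (rW : hom (W ⊗ Z) F) (lW : hom (W ⊗ Z) H) :
  lW ∘ (m ⊠ idm Z) = k ∘ ((g ⊠ idm E) ∘ (assoc_inv _ _ _ ∘ ((idm X ⊠ (r ⊠ l))
    ∘ ((idm X ⊠ tens_delta Y Z) ∘ assoc X Y Z)))) ->
  rW ∘ (m ⊠ idm Z) = f ∘ ((idm X ⊠ r) ∘ assoc X Y Z) ->
  ((rW ⊠ lW) ∘ tens_delta W Z) ∘ (m ⊠ idm Z)
  = (idm F ⊠ k) ∘ (assoc _ _ _ ∘ ((((f ⊠ g) ∘ tens_delta X D) ⊠ idm E)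
     ∘ (assoc_inv _ _ _ ∘ ((idm X ⊠ ((r ⊠ l) ∘ tens_delta Y Z)) ∘ assoc X Y Z)))).
Proof.
move=> hl hr; rewrite comp_assoc (tensm_delta m (coalg_id Z)) -comp_assoc -tensm_comp hl hr.
have nl := @tens_delta_natl X (coalg_tens Y Z) D E F G H r l f g k.
(* [nl] treats [Y ⊗ Z] as one coalgebra; the change of bracketing is harmless because the associator
   is a coalgebra morphism. *)
refine (etrans _ (etrans (f_equal (fun h => h ∘ assoc X Y Z) nl) _)).
  2: by rewrite /= !comp_assoc.
rewrite comp_assoc (assoc_delta X Y Z) -[RHS]comp_assoc.
by rewrite -(tensm_comp _ (assoc X Y Z)) !comp_assoc.
Qed.

Lemma twist_comp_r (X Y Z W D : Coalgebra M) (E F G H : M)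
    (m : CoalgHom (coalg_tens Y Z) W) (r : hom (X ⊗ Y) E)
    (l : CoalgHom (coalg_tens X Y) D) (f : hom (D ⊗ Z) F) (g : hom (D ⊗ Z) G)
    (k : hom (E ⊗ F) H) (rW : hom (X ⊗ W) H) (lW : hom (X ⊗ W) G) :
  rW ∘ (idm X ⊠ m) = k ∘ ((idm E ⊠ f) ∘ (assoc _ _ _ ∘ (((r ⊠ l) ⊠ idm Z)
    ∘ ((tens_delta X Y ⊠ idm Z) ∘ assoc_inv X Y Z)))) ->
  lW ∘ (idm X ⊠ m) = g ∘ ((l ⊠ idm Z) ∘ assoc_inv X Y Z) ->
  ((rW ⊠ lW) ∘ tens_delta X W) ∘ (idm X ⊠ m)
  = (k ⊠ idm G) ∘ (assoc_inv _ _ _ ∘ ((idm E ⊠ ((f ⊠ g) ∘ tens_delta D Z))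
     ∘ (assoc _ _ _ ∘ ((((r ⊠ l) ∘ tens_delta X Y) ⊠ idm Z) ∘ assoc_inv X Y Z)))).
Proof.
move=> hr hl; rewrite comp_assoc (tensm_delta (coalg_id X) m) -comp_assoc -tensm_comp hl hr.
have nr := @tens_delta_natr (coalg_tens X Y) D Z E F G H r l f g k.
refine (etrans _ (etrans (f_equal (fun h => h ∘ assoc_inv X Y Z) nr) _)).
  2: by rewrite /= !comp_assoc.
rewrite comp_assoc (inv_delta (f := coalg_assoc X Y Z) (assocK X Y Z) (assoc_invK X Y Z)).
by rewrite -[RHS]comp_assoc -(tensm_comp _ (assoc_inv X Y Z)) !comp_assoc.
Qed.

(** Since [i] and [lunit C] are coalgebra morphisms, the left side reduces to [delta C] followed by
    [idm C ⊠ (u ∘ eps C)], and the counit law finishes. *)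
Lemma tens_delta_unit_l C D (X : M) (i : CoalgHom (coalg_unit M) D) (u : hom tunit X)
    (f : hom (D ⊗ C) C) (g : hom (D ⊗ C) X) :
  f ∘ (i ⊠ idm C) = lunit C ->
  g ∘ (i ⊠ idm C) = lunit _ ∘ ((eps C ⊠ u) ∘ (runit_inv C ∘ lunit C)) ->
  ((f ⊠ g) ∘ tens_delta D C) ∘ (i ⊠ idm C) = (idm C ⊠ u) ∘ (runit_inv C ∘ lunit C).
Proof.
rewrite -2!(comp_assoc _ (runit_inv C)) -(comp_assoc (lunit X)) eps_unit_l => hf hg.
rewrite comp_assoc (tensm_delta i (coalg_id C)) -comp_assoc -tensm_comp hf hg.
rewrite -{1}[lunit C]comp_idl tensm_comp comp_assoc -lunit_delta.
rewrite -{1}[idm C]comp_idl tensm_comp !comp_assoc.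
congr (_ ∘ _); rewrite -comp_assoc; congr (_ ∘ _); apply: (comp_can_l (runitK C)).
by rewrite counit_r runit_invK.
Qed.

Lemma tens_delta_unit_r C D (X : M) (i : CoalgHom (coalg_unit M) D) (u : hom tunit X)
    (f : hom (C ⊗ D) X) (g : hom (C ⊗ D) C) :
  f ∘ (idm C ⊠ i) = runit _ ∘ ((u ⊠ eps C) ∘ (lunit_inv C ∘ runit C)) ->
  g ∘ (idm C ⊠ i) = runit C ->
  ((f ⊠ g) ∘ tens_delta C D) ∘ (idm C ⊠ i) = (u ⊠ idm C) ∘ (lunit_inv C ∘ runit C).
Proof.
rewrite -2!(comp_assoc _ (lunit_inv C)) -(comp_assoc (runit X)) eps_unit_r => hf hg.
rewrite comp_assoc (tensm_delta (coalg_id C) i) -comp_assoc -tensm_comp hf hg.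
rewrite -{2}[runit C]comp_idl tensm_comp comp_assoc -runit_delta.
rewrite -{1}[idm C]comp_idl tensm_comp !comp_assoc.
congr (_ ∘ _); rewrite -comp_assoc; congr (_ ∘ _); apply: (comp_can_l (lunitK C)).
by rewrite counit_l lunit_invK.
Qed.

End CoalgebraCalculus.

(** * Morphisms out of tensor products of coproducts *)

Section Sums.
Variables (M : MonoidalCategory) (S : Type) (D : SDistributive M S).

(** Distributivity concerns the chosen [sum D X]; any other coproduct of the same family is a
    retract of it. *)
Lemma coproduct_tensr_ext (X : S -> M) (Q : M) (s : forall i, hom (X i) Q)
    (c : Coproduct s) (Y Z : M) (f g : hom (Q ⊗ Y) Z) :
  (forall i, f ∘ (s i ⊠ idm Y) = g ∘ (s i ⊠ idm Y)) -> f = g.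
Proof.
move=> fg; pose t := cotuple (sum_coprod D X) s; pose t' := cotuple c (sum_in D X).
have tt' : t ∘ t' = idm Q.
  apply: (cotuple_ext c) => i.
  by rewrite comp_assoc !cotuple_in comp_idl.
apply: (@comp_can_r _ _ _ _ (t ⊠ idm Y) (t' ⊠ idm Y)).
  by rewrite -tensm_comp tt' comp_idl tensm_id.
apply: (cotuple_ext (sum_distr D Y X)) => i.
by rewrite !comp_assoc -tensm_comp (cotuple_in (sum_coprod D X)) comp_idl.
Qed.

Lemma sum2_ext (X Y : S -> M) (Z : M) (f g : hom (sum D X ⊗ sum D Y) Z) :
  (forall u v, f ∘ (sum_in D X u ⊠ sum_in D Y v) = g ∘ (sum_in D X u ⊠ sum_in D Y v)) ->
  f = g.
Proof.
move=> fg; rewrite (cotuple2_uniq (f := fun u v => g ∘ (sum_in D X u ⊠ sum_in D Y v)) fg).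
by rewrite -(cotuple2_uniq (f := fun u v => g ∘ (sum_in D X u ⊠ sum_in D Y v)) (h := g)).
Qed.

(* [X_u ⊗ (⊕_v Y_v)] is a coproduct which is not literally of the form [sum D _], whence
   the use of [coproduct_tensr_ext]. *)
Lemma sum3_ext (X Y Z : S -> M) (W : M) (f g : hom ((sum D X ⊗ sum D Y) ⊗ sum D Z) W) :
  (forall u v w, f ∘ ((sum_in D X u ⊠ sum_in D Y v) ⊠ sum_in D Z w)
               = g ∘ ((sum_in D X u ⊠ sum_in D Y v) ⊠ sum_in D Z w)) ->
  f = g.
Proof.
move=> fg; apply: (cotuple_ext (sum_distl D _ Z)) => w.
apply: (coproduct_tensr_ext (sum_distr D (sum D Y) X)) => u.
apply: (coproduct_tensr_ext (sum_distl D (X u) Y)) => v.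
by rewrite !comp_assoc -!tensm_comp !comp_idl !comp_idr fg.
Qed.

End Sums.

(** * Initial objects and domains *)

Section Initial.
Variable M : MonoidalCategory.

Lemma initial_eq (X Y : M) (f g : hom X Y) : is_initial X -> f = g.
Proof. by move=> /(_ Y) [h hP]; rewrite (hP f) (hP g). Qed.

Lemma not_initial_tens (X Y : M) : is_domain M ->
  ~ is_initial (X ⊗ Y) <-> ~ is_initial X /\ ~ is_initial Y.
Proof. by move=> /(_ X Y); tauto. Qed.

End Initial.

(** * The twisting map of a matched pair *)

Section MatchedPairTheory.
Variables (M : BraidedCategory) (S : Type).
Variables (A B : EnrichedCategory (Coalg M) S) (P : MatchedPair A B).

Local Notation uA := (underlying A).
Local Notation uB := (underlying B).

(** The target index [p] is kept apart from [mbar P x y z], so that the equalities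
    between values of [mbar] never appear as casts in the axioms for [rtilde_at]. *)
Definition act_r_at x y z p (e : mbar P x y z = p) :
    CoalgHom (coalg_tens (B x y) (A y z)) (A x p) :=
  match e in _ = q return CoalgHom (coalg_tens (B x y) (A y z)) (A x q)
  with eq_refl => mright P x y z end.

Definition act_l_at x y z p (e : mbar P x y z = p) :
    CoalgHom (coalg_tens (B x y) (A y z)) (B p z) :=
  match e in _ = q return CoalgHom (coalg_tens (B x y) (A y z)) (B q z)
  with eq_refl => mleft P x y z end.

Definition rtilde_at x y z p (e : mbar P x y z = p) :
    hom (uB x y ⊗ uA y z) (uA x p ⊗ uB p z) :=
  (act_r_at e ⊠ act_l_at e) ∘ tens_delta (B x y) (A y z).

Lemma cast_act_r x y z p (e : mbar P x y z = p) :
  cast_r uA x e ∘ act_r P x y z = act_r_at e.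
Proof. by case: p / e; rewrite comp_idl. Qed.

Lemma cast_act_l x y z p (e : mbar P x y z = p) :
  cast_l uB z e ∘ act_l P x y z = act_l_at e.
Proof. by case: p / e; rewrite comp_idl. Qed.

(** The index equality belongs to the conclusion, since axiom (ii) provides it only on non-initial
    objects. *)
Lemma rtilde_comp_B x y z t p (ep : mbar P y z t = p) q (eq : mbar P x y p = q) :
  ~ is_initial ((uB x y ⊗ uB y z) ⊗ uA z t) ->
  exists e : mbar P x z t = q,
    rtilde_at e ∘ (ecomp uB x y z ⊠ idm (uA z t))
    = (idm _ ⊠ ecomp uB q p t) ∘ (assoc _ _ _ ∘ ((rtilde_at eq ⊠ idm _)
      ∘ (assoc_inv _ _ _ ∘ ((idm _ ⊠ rtilde_at ep) ∘ assoc _ _ _)))).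
Proof.
case: p / ep eq => eq /(mp_comp_B (mpdataP P)) [e0 [hl hr]].
have e : mbar P x z t = q by rewrite -e0.
(* Once [q] is [mbar P x z t], [e0] and [eq] prove the same equation; identifying them turns the
   casts of axiom (ii) into [act_l_at eq] and [act_r_at eq]. *)
exists e; move: eq; case: q / e => eq; rewrite (proof_irrelevance _ e0 eq) in hl hr.
rewrite cast_act_l in hl; rewrite -comp_assoc cast_act_r in hr.
exact: twist_comp_l.
Qed.

Lemma rtilde_comp_A x y z t p (ep : mbar P x y z = p) q (eq : mbar P p z t = q) :
  ~ is_initial (uB x y ⊗ (uA y z ⊗ uA z t)) ->
  exists e : mbar P x y t = q,
    rtilde_at e ∘ (idm (uB x y) ⊠ ecomp uA y z t)
    = (ecomp uA x p q ⊠ idm _) ∘ (assoc_inv _ _ _ ∘ ((idm _ ⊠ rtilde_at eq)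
      ∘ (assoc _ _ _ ∘ ((rtilde_at ep ⊠ idm _) ∘ assoc_inv _ _ _)))).
Proof.
case: p / ep eq => eq /(mp_comp_A (mpdataP P)) [e0 [hr hl]].
have e : mbar P x y t = q by rewrite -e0.
exists e; move: eq; case: q / e => eq; rewrite (proof_irrelevance _ e0 eq) in hl hr.
rewrite cast_act_r in hr; rewrite -comp_assoc cast_act_l in hl.
exact: twist_comp_r.
Qed.

Lemma rtilde_unit_B x y : ~ is_initial (uA x y) ->
  exists e : mbar P x x y = y,
    rtilde_at e ∘ (eid uB x ⊠ idm (uA x y)) = (idm _ ⊠ eid uB y) ∘ (runit_inv _ ∘ lunit _).
Proof.
move=> /(mp_unit_B (mpdataP P)) [e [hl hr]]; exists e.
rewrite -comp_assoc cast_act_l in hl; rewrite -comp_assoc cast_act_r in hr.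
exact: (tens_delta_unit_l (i := eid B x) hr hl).
Qed.

Lemma rtilde_unit_A x y : ~ is_initial (uB x y) ->
  exists e : mbar P x y y = x,
    rtilde_at e ∘ (idm (uB x y) ⊠ eid uA y) = (eid uA x ⊠ idm _) ∘ (lunit_inv _ ∘ runit _).
Proof.
move=> /(mp_unit_A (mpdataP P)) [e [hl hr]]; exists e.
rewrite -comp_assoc cast_act_l in hl; rewrite -comp_assoc cast_act_r in hr.
exact: (tens_delta_unit_r (i := eid A y) hr hl).
Qed.

(** This is where the braiding axiom of a matched pair enters. *)
Definition rtilde_hom x y z :
    CoalgHom (coalg_tens (B x y) (A y z))
      (coalg_tens (A x (mbar P x y z)) (B (mbar P x y z) z)).
Proof.
refine (@Build_CoalgHom M (coalg_tens (B x y) (A y z))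
  (coalg_tens (A x (mbar P x y z)) (B (mbar P x y z) z)) (rtilde P x y z) _ _).
- exact: (delta_pair (f := mright P x y z) (g := mleft P x y z) (mp_braid (mpdataP P) x y z)).
- exact: (eps_pair (mright P x y z) (mleft P x y z)).
Defined.

End MatchedPairTheory.

(** * The bicrossed product: category axioms and coalgebra structure *)

Section BicrossedTheory.
Variables (M : BraidedCategory) (S : Type) (D : SDistributive M S).
Variables (A B : EnrichedCategory (Coalg M) S) (P : MatchedPair A B).
Hypothesis hM : is_domain M.

Local Notation uA := (underlying A).
Local Notation uB := (underlying B).

(** The free index [p] allows composites in propositionally equal summands to be compared without
    casts. *)
Lemma bicrossed_comp_in x y z u v p (e : mbar P u y v = p) :
  ecomp (bicrossed D P) x y z ∘ (bicrossed_in D A B x y u ⊠ bicrossed_in D A B y z v)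
  = bicrossed_in D A B x z p
    ∘ ((ecomp uA x u p ⊠ ecomp uB p v z) ∘ mid (uA x u) (rtilde_at e) (uB v z)).
Proof.
case: p / e.
exact: (@cotuple2_in _ _ D (fun u => uA x u ⊗ uB u y) (fun v => uA y v ⊗ uB v z)
  (sum D (fun w => uA x w ⊗ uB w z)) (fun u v => bicrossed_in D A B x z (mbar P u y v)
    ∘ ((ecomp uA x u _ ⊠ ecomp uB _ v z) ∘ mid (uA x u) (rtilde P u y v) (uB v z)))).
Qed.

(** Forgetting coalgebra structures is strictly monoidal, so the axiom transfers verbatim. *)
Lemma underlying_assoc (C : EnrichedCategory (Coalg M) S) x y z t :
  ecomp (underlying C) x z t ∘ (ecomp (underlying C) x y z ⊠ idm _)
  = ecomp (underlying C) x y t ∘ ((idm _ ⊠ ecomp (underlying C) y z t) ∘ assoc _ _ _).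
Proof. by have := f_equal (@cmor _ _ _) (ecomp_assoc (egraphP C) x y z t). Qed.

Lemma underlying_idl (C : EnrichedCategory (Coalg M) S) x y :
  ecomp (underlying C) x x y ∘ (eid (underlying C) x ⊠ idm _) = lunit _.
Proof. by have := f_equal (@cmor _ _ _) (ecomp_idl (egraphP C) x y). Qed.

Lemma underlying_idr (C : EnrichedCategory (Coalg M) S) x y :
  ecomp (underlying C) x y y ∘ (idm _ ⊠ eid (underlying C) y) = runit _.
Proof. by have := f_equal (@cmor _ _ _) (ecomp_idr (egraphP C) x y). Qed.

Lemma bicrossed_assoc x y z t :
  ecomp (bicrossed D P) x z t ∘ (ecomp (bicrossed D P) x y z ⊠ idm _)
  = ecomp (bicrossed D P) x y t ∘ ((idm _ ⊠ ecomp (bicrossed D P) y z t) ∘ assoc _ _ _).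
Proof.
apply: sum3_ext => u v w.
case: (classic (is_initial (((uA x u ⊗ uB u y) ⊗ (uA y v ⊗ uB v z)) ⊗ (uA z w ⊗ uB w t))))
  => [/initial_eq|]; first exact.
have nt := fun X Y : M => @not_initial_tens M X Y hM.
case/nt => /nt [/nt [nA1 nB1] /nt [nA2 nB2]] /nt [nA3 nB3].
(* Axiom (i) keeps the outputs of the twisting maps non-initial, so that axioms (ii) and (iii) can
   be applied to them. *)
have /nt [nAp nBp] := mp_initial (mpdataP P) (proj2 (nt _ _) (conj nB1 nA2)).
have /nt [nAr nBr] := mp_initial (mpdataP P) (proj2 (nt _ _) (conj nB2 nA3)).
have ni_B := proj2 (nt _ _) (conj (proj2 (nt _ _) (conj nBp nB2)) nA3).
have ni_A := proj2 (nt _ _) (conj nB1 (proj2 (nt _ _) (conj nA2 nAr))).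
(* With [p] for [mbar P u y v] and [r] for [mbar P v z w], both bracketings land in the summand of
   index [mbar P p v r]. *)
have [e h1] := rtilde_comp_B (P := P) erefl erefl ni_B.
have [e' h2] := rtilde_comp_A (P := P) erefl erefl ni_A.
have cX a b c : bicrossed_in D A B a b c = sum_in D (fun c => uA a c ⊗ uB c b) c by [].
rewrite -!cX comp_assoc -tensm_comp comp_idl (bicrossed_comp_in _ _ erefl).
rewrite -[bicrossed_in D A B z t w in LHS]comp_idr tensm_comp -comp_assoc.
rewrite (bicrossed_comp_in _ _ e) comp_assoc.
rewrite [RHS]comp_assoc (comp_assoc _ (assoc _ _ _)) assoc_nat.
rewrite -(comp_assoc (idm _ ⊠ ecomp (bicrossed D P) y z t)) -tensm_comp comp_idl.
rewrite (bicrossed_comp_in _ _ erefl) -[bicrossed_in D A B x y u in RHS]comp_idr.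
rewrite (tensm_comp (bicrossed_in _ _ _ x y u)) (comp_assoc (bicrossed_in _ _ _ x y u ⊠ _)).
rewrite [RHS](comp_assoc_eq _ (bicrossed_comp_in _ _ e')) [RHS]comp_assoc; congr (_ ∘ _).
exact: (twist_assoc h1 h2 (underlying_assoc _ _ _ _ _) (underlying_assoc _ _ _ _ _)).
Qed.

Lemma bicrossed_idl x y :
  ecomp (bicrossed D P) x x y ∘ (eid (bicrossed D P) x ⊠ idm _) = lunit _.
Proof.
apply: (cotuple_ext (sum_distl D tunit (fun u => uA x u ⊗ uB u y))) => u.
case: (classic (is_initial (uA x u ⊗ uB u y))) => [i|/(not_initial_tens _ _ hM) [nA nB]].
  by apply: initial_eq; apply/hM; right.
(* Axiom (iv) gives [mbar P x x u = u]: composing with the identity stays in the summand [u]. *)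
have [e h] := rtilde_unit_B P nA.
have h' := bicrossed_comp_in x y e.
rewrite comp_assoc -tensm_comp comp_idl comp_idr lunit_nat.
rewrite /eid /= -/(bicrossed_in D A B x y u).
rewrite -[bicrossed_in D A B x y u in LHS]comp_idr tensm_comp -comp_assoc.
rewrite [ecomp (bicrossed D P) x x y ∘ _]h' comp_assoc; congr (_ ∘ _).
exact: (twist_unit_l h (underlying_idl _ _ _) (underlying_idl _ _ _)).
Qed.

Lemma bicrossed_idr x y :
  ecomp (bicrossed D P) x y y ∘ (idm _ ⊠ eid (bicrossed D P) y) = runit _.
Proof.
apply: (cotuple_ext (sum_distr D tunit (fun u => uA x u ⊗ uB u y))) => u.
case: (classic (is_initial (uA x u ⊗ uB u y))) => [i|/(not_initial_tens _ _ hM) [nA nB]].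
  by apply: initial_eq; apply/hM; left.
have [e h] := rtilde_unit_A P nB.
have h' := bicrossed_comp_in x y e.
rewrite comp_assoc -tensm_comp comp_idl comp_idr runit_nat.
rewrite /eid /= -/(bicrossed_in D A B x y u).
rewrite -[bicrossed_in D A B x y u in LHS]comp_idr tensm_comp -comp_assoc.
rewrite [ecomp (bicrossed D P) x y y ∘ _]h' comp_assoc; congr (_ ∘ _).
exact: (twist_unit_r h (underlying_idr _ _ _) (underlying_idr _ _ _)).
Qed.

(** The inclusions are coalgebra morphisms and, by distributivity, their tensor products are jointly
    epic. *)
Lemma sum2_hom (X Y : S -> Coalgebra M) (Z : Coalgebra M) (h : hom (sum D X ⊗ sum D Y) Z)
    (k : forall u v, CoalgHom (coalg_tens (X u) (Y v)) Z) :
  (forall u v, h ∘ (sum_in D X u ⊠ sum_in D Y v) = k u v) ->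
  delta Z ∘ h = (h ⊠ h) ∘ tens_delta (sum_coalg D X) (sum_coalg D Y)
  /\ eps Z ∘ h = tens_eps (sum_coalg D X) (sum_coalg D Y).
Proof.
move=> hk; split; apply: sum2_ext => u v.
- rewrite [LHS]comp_assoc [RHS]comp_assoc hk (cmor_delta (k u v)).
  have -> := tensm_delta (sum_coalg_in D X u) (sum_coalg_in D Y v).
  by rewrite -[RHS]comp_assoc -tensm_comp /= hk.
- rewrite comp_assoc hk (cmor_eps (k u v)).
  by have -> := tensm_eps (sum_coalg_in D X u) (sum_coalg_in D Y v).
Qed.

(** Composing inside [Coalg M] makes compatibility with the coalgebra structures automatic; the
    underlying morphism is the defining formula of the composition on a summand. *)
Definition bicrossed_summand_hom x y z u v :
    CoalgHom (coalg_tens (coalg_tens (A x u) (B u y)) (coalg_tens (A y v) (B v z)))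
      (bicrossed_coalg D A B x z) :=
  @comp (Coalg M) _ _ _ (sum_coalg_in D (fun u => coalg_tens (A x u) (B u z)) (mbar P u y v))
    (@comp (Coalg M) _ _ _ (ecomp A x u (mbar P u y v) ⊠ ecomp B (mbar P u y v) v z)
      (@mid (Coalg M) (A x u) _ _ _ _ (rtilde_hom P u y v) (B v z))).

Lemma bicrossed_comp_coalg x y z :
  let h := ecomp (bicrossed D P) x y z in
  delta (bicrossed_coalg D A B x z) ∘ h
    = (h ⊠ h) ∘ tens_delta (bicrossed_coalg D A B x y) (bicrossed_coalg D A B y z)
  /\ eps (bicrossed_coalg D A B x z) ∘ h
    = tens_eps (bicrossed_coalg D A B x y) (bicrossed_coalg D A B y z).
Proof.
apply: (sum2_hom (k := bicrossed_summand_hom x y z)) => u v.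
exact: (bicrossed_comp_in x z erefl).
Qed.

Definition bicrossed_comp_hom x y z :
    CoalgHom (coalg_tens (bicrossed_coalg D A B x y) (bicrossed_coalg D A B y z))
      (bicrossed_coalg D A B x z) :=
  @Build_CoalgHom M (coalg_tens (bicrossed_coalg D A B x y) (bicrossed_coalg D A B y z))
    (bicrossed_coalg D A B x z) (ecomp (bicrossed D P) x y z)
    (proj1 (bicrossed_comp_coalg x y z)) (proj2 (bicrossed_comp_coalg x y z)).

Definition bicrossed_id_hom x : CoalgHom (coalg_unit M) (bicrossed_coalg D A B x x) :=
  @comp (Coalg M) _ _ _ (sum_coalg_in D (fun u => coalg_tens (A x u) (B u x)) x)
    (@comp (Coalg M) _ _ _ (eid A x ⊠ eid B x) (@lunit_inv (Coalg M) tunit)).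

End BicrossedTheory.

Theorem proposition3p7 (M : BraidedCategory) (S : Type) (D : SDistributive M S)
    (hM : is_domain M) (A B : EnrichedCategory (Coalg M) S) (P : MatchedPair A B) :
  is_enriched_category (bicrossed D P) /\
  exists (c : forall x y z : S,
            hom (bicrossed_coalg D A B x y ⊗ bicrossed_coalg D A B y z)
                (bicrossed_coalg D A B x z))
         (i : forall x : S, hom tunit (bicrossed_coalg D A B x x)),
    (forall x y z : S, cmor (c x y z) = ecomp (bicrossed D P) x y z) /\
    (forall x : S, cmor (i x) = eid (bicrossed D P) x) /\
    is_enriched_category
      {| ehom := bicrossed_coalg D A B; ecomp := c; eid := i |}.
Proof.
have eA := bicrossed_assoc D P hM.
have el := bicrossed_idl D P hM.
have er := bicrossed_idr D P hM.
split; first by split.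
exists (bicrossed_comp_hom D P), (bicrossed_id_hom D A B).
(* Coalgebra morphisms are equal when their underlying morphisms are, so the axioms reduce to those
   in [M]. *)
split=> //; split=> //; split=> *; apply: CoalgHom_eq.
- exact: eA.
- exact: el.
- exact: er.
Qed.
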